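(* Let $n$ be a nonnegative integer. On any interval of values $\alpha\in(-1,1)$ not including a tip of a V-shape of $E_n$, the alternation points $\{u_i(\alpha)\}_{i=0}^{k}$ and $\{v_j(\alpha)\}_{j=0}^{\ell}$ are non-decreasing in $\alpha$.
   Context: For $\alpha\in[-1,1]$ let $f(x;\alpha)=|x-\alpha|$, $x\in[-1,1]$. For a nonnegative integer $n$ let $\mathbb{P}_n$ be the space of real polynomials of degree at most $n$, $\|\cdot\|$ the uniform norm on $[-1,1]$, $E_n(\alpha)=\min_{q\in\mathbb{P}_n}\|f(\cdot;\alpha)-q\|$, and let $p_n(x;\alpha)\in\mathbb{P}_n$ be the unique minimizer (the minimax polynomial). V-shapes: $E_n$ has a V-shape on $[a,b]$ if there is $c\in(a,b)$ such that $E_n$ is continuous on $[a,b]$, linear and decreasing on $[a,c]$, and linear and increasing on $[c,b]$. If $[a,b]$ is a maximal interval with this property, it is called a V-shape of $E_n$; $a,b$ are its endpoints and $c$ is its tip. Alternation points: for $\alpha\in(-1,1)$, the alternation points are the points $x\in[-1,1]$ with $|f(x;\alpha)-p_n(x;\alpha)|=E_n(\alpha)$; it is known that the signs of $f-p_n$ alternate along them, that there are exactly $n+2$ or $n+3$ of them, that $n+3$ occurs only at tips of V-shapes, and that $\alpha$ is always one of them, with $p_n(\alpha;\alpha)=E_n(\alpha)$. Those to the left of $\alpha$ are denoted $u_i=u_i(\alpha)$ and those to the right $v_j=v_j(\alpha)$, enumerated by distance to $\alpha$: the alternation set is $$\mathcal{A}_n(\alpha)=\{u_{k+1}(\alpha)<\dots<u_1(\alpha)<\alpha<v_1(\alpha)<\dots<v_{\ell+1}(\alpha)\},$$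 where $k=k(\alpha)$, $\ell=\ell(\alpha)$. Also $u_0(\alpha)=v_0(\alpha)=\alpha$. It is known that if $\alpha$ is not in a V-shape of $E_n$ then there are exactly $n+2$ alternation points and $\pm1$ are among them, so $u_{k+1}=-1$, $v_{\ell+1}=1$ and $k+\ell=n-1$. *)

(* Defs.v *)
From HB Require Import structures.
From mathcomp Require Import all_boot all_order all_algebra finmap.
From mathcomp Require Import all_classical all_reals all_analysis.
Set Implicit Arguments.
Unset Strict Implicit.
Unset Printing Implicit Defensive.
Import Order.TTheory GRing.Theory Num.Theory numFieldNormedType.Exports.
Local Open Scope classical_set_scope.
Local Open Scope ring_scope.

Section Minimax.
Variable R : realType.
Implicit Types (n i j : nat) (alpha a b c : R) (p q : {poly R}) (B : set R).

Definition unorm (g : R -> R) : R := sup [set `|g x| | x in `[-1, 1]].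

Definition absf alpha : R -> R := fun x => `|x - alpha|.

Definition err alpha p : R -> R := fun x => absf alpha x - p.[x].

(* [size p] is [degree p + 1]. *)
Definition deg_le n : set {poly R} := [set p | (size p <= n.+1)%N].

Definition minimax_error n alpha : R :=
  inf [set unorm (err alpha q) | q in deg_le n].

Definition is_minimax n alpha p : Prop :=
  deg_le n p /\ unorm (err alpha p) = minimax_error n alpha.

(* The default value 0 of [xget] is never used: a minimax polynomial exists
   and is unique. *)
Definition minimax_poly n alpha : {poly R} := xget 0 (is_minimax n alpha).

Definition affine_on (g : R -> R) a b : Prop :=
  exists m t, forall x, x \in `[a, b] -> g x = m * x + t.

Definition has_vshape n a b c : Prop :=
  [/\ -1 <= a /\ b <= 1,
      c \in `]a, b[,
      {within `[a, b], continuous (minimax_error n)},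
      affine_on (minimax_error n) a c /\
        {in `[a, c] &, {homo minimax_error n : x y /~ x < y}} &
      affine_on (minimax_error n) c b /\
        {in `[c, b] &, {homo minimax_error n : x y / x < y}}].

Definition vshape n a b c : Prop :=
  has_vshape n a b c /\
  forall a' b' c', has_vshape n a' b' c' ->
    a' <= a -> b <= b' -> a' = a /\ b' = b.

Definition vshape_tip n c : Prop := exists a b, vshape n a b c.

Definition alternation_set n alpha : set R :=
  [set x | x \in `[-1, 1] /\
     `|err alpha (minimax_poly n alpha) x| = minimax_error n alpha].

(* [fset_set B] lists the elements of [B] when [B] is finite, which is the
   case below. *)
Definition by_distance alpha B : seq R :=
  sort (fun x y => `|x - alpha| <= `|y - alpha|) (enum_fset (fset_set B)).

(* [:: u_1; u_2; ...; u_{k+1}] *)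
Definition left_points n alpha : seq R :=
  by_distance alpha (alternation_set n alpha `&` [set x | x < alpha]).

(* [:: v_1; v_2; ...; v_{l+1}] *)
Definition right_points n alpha : seq R :=
  by_distance alpha (alternation_set n alpha `&` [set x | alpha < x]).

(* The indices are integers because they can be -1: for n = 0 and alpha > 0
   the alternation points are -1 and alpha, hence l = -1. *)
Definition left_index n alpha : int := (size (left_points n alpha))%:Z - 1.
Definition right_index n alpha : int := (size (right_points n alpha))%:Z - 1.

(* [upoint n i alpha] is u_i(alpha), with u_0(alpha) = alpha; it is meaningful
   for i <= k(alpha) + 1 only.  Similarly for [vpoint]. *)
Definition upoint n i alpha : R := nth alpha (alpha :: left_points n alpha) i.
Definition vpoint n j alpha : R := nth alpha (alpha :: right_points n alpha) j.

End Minimax.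

(* Main.v *)
(* Normalise the error of the best approximation p(.;a) to |x - a| as e/E, so
   that it takes the values 1 and -1 alternately on the alternation set.  For
   a < b the difference D of the two normalised errors is phi - q, where q is a
   polynomial of degree at most n and phi equals -L on [-1, a] and L on [b, 1]
   for one affine function L, which is nonnegative on [-1, 1] because E(a)/(1 + a)
   is nonincreasing and E(a)/(1 - a) nondecreasing in a (rescale the window).
   The divided difference of phi over n + 2 nodes outside (a, b) therefore has a
   known sign, and q does not contribute to it.  If an alternation point moved to
   the left, splicing the two alternation sets would give n + 2 nodes at which D
   alternates with the opposite sign; then D vanishes at all of them, so that one
   of the two alternation sets has too many points.

   A point with n + 3 alternation points is the tip of a V-shape: rescaling
   towards either end of [-1, 1] keeps n + 2 of them.  Away from tips the
   alternation set is exactly an alternant of n + 2 points containing a (the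
   critical points of the error are counted by a divided difference of the sign
   function), and strong unicity makes the rank of a in it locally constant. *)
Require Import Defs.
From HB Require Import structures.
From mathcomp Require Import all_boot all_order all_algebra finmap.
From mathcomp Require Import all_classical all_reals all_analysis.
From mathcomp Require Import polyrcf zify ring lra.
Import Order.TTheory GRing.Theory Num.Theory numFieldNormedType.Exports.
Set Implicit Arguments.
Unset Strict Implicit.
Unset Printing Implicit Defensive.
Local Open Scope classical_set_scope.
Local Open Scope ring_scope.

(** * Divided differences *)

(* [lia] would otherwise preprocess every hypothesis about real numbers. *)
Ltac nlia :=
  repeat match goal with H : ?T |- _ =>
    lazymatch T with
    | is_true (leq _ _) => fail
    | is_true (andb _ _) => fail
    | is_true (orb _ _) => fail
    | is_true (negb _) => fail
    | @eq ?X _ _ => tryif first [unify X nat | unify X bool] then fail else clear H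
    | _ => clear H
    end
  end; lia.

(* Likewise for quantified hypotheses and real arithmetic. *)
Ltac slra :=
  repeat match goal with H : forall _, _ |- _ => clear H end; lra.

Section DividedDifferences.
Variable R : realType.
Implicit Types (t g h : nat -> R) (i j m N P : nat).

Definition increasing_upto N t := forall j, (j < N)%N -> t j < t j.+1.

Lemma increasing_lt N t i j :
  increasing_upto N t -> (i < j <= N)%N -> t i < t j.
Proof.
move=> tN; elim: j => [|j IH] //; rewrite ltnS leq_eqVlt => /andP[].
case: eqP => [-> _|_ /= ij] jN; first exact: tN.
by rewrite (lt_trans (IH _) (tN _ jN)) // ij ltnW.
Qed.

Lemma increasing_le N t i j :
  increasing_upto N t -> (i <= j <= N)%N -> t i <= t j.
Proof.
move=> tN /andP[]; rewrite leq_eqVlt => /orP[/eqP->//|ij jN].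
by apply/ltW/(increasing_lt tN); rewrite ij.
Qed.

Lemma increasing_ltE N t i j : increasing_upto N t ->
  (i <= N)%N -> (j <= N)%N -> (t i < t j) = (i < j)%N.
Proof.
move=> tN iN jN; case: (ltnP i j) => ij.
  by apply: (increasing_lt tN); rewrite ij.
by apply/negbTE; rewrite -leNgt; apply: (increasing_le tN); rewrite ij.
Qed.

Lemma increasing_inj N t i j : increasing_upto N t ->
  (i <= N)%N -> (j <= N)%N -> t i = t j -> i = j.
Proof.
move=> tN iN jN tij.
have := increasing_ltE tN iN jN; have := increasing_ltE tN jN iN.
by rewrite tij ltxx; nlia.
Qed.

(** The divided difference of order [m] over the nodes [t i, ..., t (i + m)]. The data [g] are
    indexed by the number of the node, so that sign patterns in the index count as data too. *)
Fixpoint dd t g m i : R :=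
  if m is m'.+1 then (dd t g m' i.+1 - dd t g m' i) / (t (i + m)%N - t i)
  else g i.

Lemma eq_dd t g h m i :
  (forall j, (i <= j <= i + m)%N -> g j = h j) -> dd t g m i = dd t h m i.
Proof.
elim: m i => [|m IH] i gh /=; first by apply: gh; nlia.
by rewrite !IH // => j jm; apply: gh; nlia.
Qed.

Lemma ddD t g h m i : dd t (fun j => g j + h j) m i = dd t g m i + dd t h m i.
Proof. by elim: m i => //= m IH i; rewrite !IH; ring. Qed.

Lemma ddZ t g a m i : dd t (fun j => a * g j) m i = a * dd t g m i.
Proof. by elim: m i => //= m IH i; rewrite !IH; ring. Qed.

Lemma ddB t g h m i : dd t (fun j => g j - h j) m i = dd t g m i - dd t h m i.
Proof. by elim: m i => //= m IH i; rewrite !IH; ring. Qed.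

Lemma dd_cst t a m i : dd t (fun=> a) m.+1 i = 0.
Proof.
elim: m i => [|m IH] i; first by rewrite /= subrr mul0r.
by rewrite [LHS]/= -/(dd _ _ m.+1 _) -/(dd _ _ m.+1 _) !IH subrr mul0r.
Qed.

Lemma ddE t g m i : dd t g m.+1 i =
  (dd t g m i.+1 - dd t g m i) / (t (i + m.+1)%N - t i).
Proof. by []. Qed.

Section Nodes.
Variables (N : nat) (t : nat -> R).
Hypothesis tN : increasing_upto N t.

Lemma node_gap i m : (i + m.+1 <= N)%N -> 0 < t (i + m.+1)%N - t i.
Proof. by move=> imN; rewrite subr_gt0; apply: (increasing_lt tN); nlia. Qed.

(** Leibniz rule for a factor equal to the node, expanded at the first node; [dd_mulXr] expands at
    the last one. *)
Lemma dd_mulX g m i : (i + m.+1 <= N)%N ->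
  dd t (fun j => t j * g j) m.+1 i = t i * dd t g m.+1 i + dd t g m i.+1.
Proof.
elim: m i => [|m IH] i imN.
  have := node_gap imN; rewrite /= addn1 => t01; field.
  by rewrite gt_eqF.
rewrite ddE IH; last by nlia.
rewrite IH; last by nlia.
have := node_gap imN => t01.
rewrite [dd t g m.+2 i]ddE.
have -> : dd t g m i.+1 =
    dd t g m i.+2 - (t (i.+1 + m.+1)%N - t i.+1) * dd t g m.+1 i.+1.
  rewrite ddE mulrC divfK ?gt_eqF ?node_gap //; first ring.
  by nlia.
have -> : (i.+1 + m.+1 = i + m.+2)%N by nlia.
by field; rewrite gt_eqF.
Qed.

Lemma dd_mulXr g m i : (i + m.+1 <= N)%N ->
  dd t (fun j => t j * g j) m.+1 i =
  t (i + m.+1)%N * dd t g m.+1 i + dd t g m i.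
Proof.
move=> imN; rewrite dd_mulX // ddE.
by field; rewrite gt_eqF ?node_gap.
Qed.

(** Induction on the order: splitting off one factor ['X] and applying the Leibniz rule lowers
    degree and order together. *)
Lemma dd_poly (q : {poly R}) m i : (size q <= m)%N -> (i + m <= N)%N ->
  dd t (fun j => q.[t j]) m i = 0.
Proof.
elim: m q i => [|m IH] q i.
  by rewrite leqn0 size_poly_eq0 => /eqP-> _; rewrite /= horner0.
elim/poly_ind: q => [_ _|q c _ sq imN].
  by rewrite (@eq_dd _ _ (fun=> 0)) ?dd_cst // => j _; rewrite horner0.
have sqm : (size q <= m)%N.
  by move: sq; rewrite size_MXaddC; case: ifP => // /andP[/eqP-> _]; rewrite size_poly0.
rewrite (@eq_dd _ _ (fun j => t j * q.[t j] + c)); last first.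
  by move=> j _; rewrite hornerMXaddC mulrC.
rewrite ddD dd_cst addr0 dd_mulX // ddE !IH //; try nlia.
by rewrite subrr mul0r mulr0 addr0.
Qed.

(** The two differences in the recursive quotient have opposite signs, so they add up without
    cancellation. *)
Lemma dd_alt g m i k : (i + m <= N)%N ->
  (forall j, (i <= j <= i + m)%N -> 0 <= (-1) ^+ (j + k) * g j) ->
  0 <= (-1) ^+ (i + m + k) * dd t g m i.
Proof.
elim: m i => [|m IH] i imN gj; first by rewrite addn0; apply: gj; nlia.
rewrite ddE mulrA divr_ge0 ?(ltW (node_gap _)) //.
have h1 := IH i.+1 ltac:(nlia) (fun j jm => gj j ltac:(nlia)).
have h2 := IH i ltac:(nlia) (fun j jm => gj j ltac:(nlia)).
move: h1 h2; rewrite !addnS !addSn !exprS mulrBr; slra.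
Qed.

(** Without cancellation each order loses at most a factor equal to the node gap, which is at most
    2. In particular, alternating data with a vanishing divided difference vanish themselves. *)
Lemma dd_alt_bound g m i k j :
  (forall j, (j <= N)%N -> t j \in `[-1, 1]) -> (i + m <= N)%N ->
  (forall j, (i <= j <= i + m)%N -> 0 <= (-1) ^+ (j + k) * g j) ->
  (i <= j <= i + m)%N -> `|g j| <= 2 ^+ m * `|dd t g m i|.
Proof.
move=> t11; elim: m i => [|m IH] i imN gj jm.
  by rewrite expr0 mul1r; have -> : j = i by nlia.
have := node_gap imN.
have h1 := @dd_alt g m i.+1 k ltac:(nlia) (fun j jm => gj j ltac:(nlia)).
have h2 := @dd_alt g m i k ltac:(nlia) (fun j jm => gj j ltac:(nlia)).
have t2 : t (i + m.+1)%N - t i <= 2.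
  have := t11 (i + m.+1)%N ltac:(nlia); have := t11 i ltac:(nlia).
  by rewrite !in_itv /=; slra.
have sgn1 p (x : R) : 0 <= (-1) ^+ p * x -> `|x| = (-1) ^+ p * x.
  by move=> /ger0_norm <-; rewrite normrM normrX normrN1 expr1n mul1r.
have dE : (t (i + m.+1)%N - t i) * `|dd t g m.+1 i| =
          `|dd t g m i.+1| + `|dd t g m i|.
  rewrite (sgn1 _ _ h1) (sgn1 _ _ h2) -[t _ - t i]gtr0_norm ?node_gap//.
  rewrite -normrM ddE mulrC divfK ?gt_eqF ?node_gap//.
  rewrite (sgn1 (i.+1 + m + k)%N); first by rewrite !addSn exprS; ring.
  by move: h1 h2; rewrite !addSn exprS; slra.
have d0 : 0 <= `|dd t g m.+1 i| by [].
have d1 : 0 <= `|dd t g m i.+1| by [].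
have d2 : 0 <= `|dd t g m i| by [].
have dle : `|dd t g m i.+1| + `|dd t g m i| <= 2 * `|dd t g m.+1 i|.
  by rewrite -dE ler_wpM2r.
move=> _; rewrite exprSr -mulrA.
have [ij|ij] := leqP i.+1 j.
  apply: (le_trans (IH i.+1 _ _ _)) => //; [nlia|by move=> ? ?; apply: gj; nlia|nlia|].
  by rewrite ler_wpM2l ?exprn_ge0//; slra.
apply: (le_trans (IH i _ _ _)) => //; [nlia|by move=> ? ?; apply: gj; nlia|nlia|].
by rewrite ler_wpM2l ?exprn_ge0//; slra.
Qed.

(** Models the sign of [x - a] at increasing nodes, the first [P] of which lie to the left. *)
Definition step P j : R := if (j < P)%N then -1 else 1.

Lemma dd_step_out m P i : ~~ (i < P <= i + m.+1)%N -> dd t (step P) m.+1 i = 0.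
Proof.
rewrite negb_and -!leqNgt -ltnNge => iP.
have [Pi|Pi] := leqP P i.
  rewrite (@eq_dd _ _ (fun=> 1)) ?dd_cst // => j /andP[ij _].
  by rewrite /step ltnNge (leq_trans Pi).
rewrite (@eq_dd _ _ (fun=> -1)) ?dd_cst // => j ij.
by rewrite /step ifT //; nlia.
Qed.

(** The two lower differences have opposite weak signs, and a jump inside the window of nodes is
    inside at least one of the two subwindows, whence strictness. *)
Lemma dd_step m P i : (i + m.+1 <= N)%N ->
  0 <= (-1) ^+ (i + m.+1 + P) * dd t (step P) m.+1 i /\
  ((i < P <= i + m.+1)%N -> 0 < (-1) ^+ (i + m.+1 + P) * dd t (step P) m.+1 i).
Proof.
move=> imN; case: (boolP (i < P <= i + m.+1)%N) => iP; last first.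
  by rewrite dd_step_out // mulr0.
suff h : 0 < (-1) ^+ (i + m.+1 + P) * dd t (step P) m.+1 i by split=> //; apply: ltW.
elim: m i imN iP => [|m IH] i imN iP.
  have -> : P = i.+1 by nlia.
  rewrite ddE /= /step ltnn ltnSn mulrA divr_gt0 ?node_gap//.
  by rewrite addn1 -signr_odd oddD addbb expr0; slra.
rewrite ddE mulrA divr_gt0 ?node_gap//.
have h1 : 0 <= (-1) ^+ (i.+1 + m.+1 + P) * dd t (step P) m.+1 i.+1 /\
  ((i.+1 < P <= i.+1 + m.+1)%N ->
    0 < (-1) ^+ (i.+1 + m.+1 + P) * dd t (step P) m.+1 i.+1).
  case: (boolP (i.+1 < P <= i.+1 + m.+1)%N) => iP1; last by rewrite dd_step_out // mulr0.
  by split=> [|_]; last (by apply: IH => //; nlia); apply/ltW/IH => //; nlia.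
have h2 : 0 <= (-1) ^+ (i + m.+1 + P) * dd t (step P) m.+1 i /\
  ((i < P <= i + m.+1)%N -> 0 < (-1) ^+ (i + m.+1 + P) * dd t (step P) m.+1 i).
  case: (boolP (i < P <= i + m.+1)%N) => iP1; last by rewrite dd_step_out // mulr0.
  by split=> [|_]; last (by apply: IH => //; nlia); apply/ltW/IH => //; nlia.
have [iP1|iP1] : (i.+1 < P <= i.+1 + m.+1)%N \/ (i < P <= i + m.+1)%N by nlia.
  by move: h1 h2 => [_ /(_ iP1)] + [+ _]; rewrite !(addnS, addSn) !exprS mulrBr; slra.
by move: h1 h2 => [+ _] [_ /(_ iP1)]; rewrite !(addnS, addSn) !exprS mulrBr; slra.
Qed.

(* Expanding at the end node where the slope and the value of the affine
   factor contribute with the same sign. *)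
Lemma dd_affine_step (c d : R) m P : (m.+2 <= N)%N ->
  0 <= c * t 0%N + d -> 0 <= c * t m.+2 + d -> (P <= m.+3)%N ->
  0 <= (-1) ^+ (m.+2 + P) * dd t (fun j => (c * t j + d) * step P j) m.+2 0.
Proof.
move=> mN L0 L1 Pm.
rewrite (@eq_dd _ _ (fun j => c * (t j * step P j) + d * step P j)); last first.
  by move=> j _; ring.
have [hs _] := @dd_step m.+1 P 0 ltac:(nlia).
have [h0 _] := @dd_step m P 0 ltac:(nlia).
have [h1 _] := @dd_step m P 1 ltac:(nlia).
rewrite ddD !ddZ; have [c0|c0] := leP 0 c.
  rewrite dd_mulX //=.
  set A := dd _ _ _ _ in hs *; set B := dd _ _ _ _ in h1 *.
  have -> : (-1) ^+ (m.+2 + P) * (c * (t 0%N * A + B) + d * A) =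
    (c * t 0%N + d) * ((-1) ^+ (m.+2 + P) * A) + c * ((-1) ^+ (m.+2 + P) * B) by ring.
  by rewrite addr_ge0 // mulr_ge0.
rewrite dd_mulXr // add0n.
set A := dd _ _ _ _ in hs *; set B := dd _ _ _ _ in h0 *.
have -> : (-1) ^+ (m.+2 + P) * (c * (t m.+2 * A + B) + d * A) =
  (c * t m.+2 + d) * ((-1) ^+ (m.+2 + P) * A) + - c * ((-1) ^+ (m.+1 + P) * B).
  by rewrite addSn exprS; ring.
rewrite add0n in h0 hs; rewrite addr_ge0 // mulr_ge0 //; slra.
Qed.

End Nodes.
End DividedDifferences.

(** * Uniform norm and minimax error *)

Section UniformNorm.
Variable R : realType.
Implicit Types (n : nat) (a b c x y : R) (p q : {poly R}) (g : R -> R).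

Lemma err_continuous a p : continuous (err a p).
Proof.
move=> x; apply: cvgB; last exact: continuous_horner.
by apply: cvg_norm; apply: cvgB; [exact: cvg_id|exact: cvg_cst].
Qed.

Lemma continuous_abs g : continuous g -> continuous (fun x => `|g x|).
Proof. by move=> gc x; apply: cvg_norm; apply: gc. Qed.

Lemma EVT_unorm g : continuous g ->
  exists2 c, c \in `[-1, 1] & forall x, x \in `[-1, 1] -> `|g x| <= `|g c|.
Proof.
move=> gc; apply: EVT_max; first by slra.
by apply: continuous_subspaceT; apply: continuous_abs.
Qed.

Lemma unorm_le g (M : R) :
  (forall x, x \in `[-1, 1] -> `|g x| <= M) -> unorm g <= M.
Proof.
move=> gM; apply: ge_sup; last by move=> _ [x /= x11 <-]; apply: gM.
by exists `|g 0|, 0 => //=; rewrite in_itv /=; slra.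
Qed.

Lemma le_unorm g x : continuous g -> x \in `[-1, 1] -> `|g x| <= unorm g.
Proof.
move=> gc x11; have [c c11 cmax] := EVT_unorm gc.
apply: ub_le_sup; last by exists x.
by exists `|g c| => _ [y /= y11 <-]; apply: cmax.
Qed.

Lemma unorm_attained g : continuous g ->
  exists2 c, c \in `[-1, 1] & `|g c| = unorm g.
Proof.
move=> gc; have [c c11 cmax] := EVT_unorm gc; exists c => //.
by apply/le_anti; rewrite le_unorm //= unorm_le.
Qed.

Lemma unorm_ge0 g : continuous g -> 0 <= unorm g.
Proof. by move=> gc; have [c _ <-] := unorm_attained gc. Qed.

Lemma minimax_error_le n a q : (size q <= n.+1)%N ->
  minimax_error n a <= unorm (err a q).
Proof.
move=> sq; apply: ge_inf; last by exists q.
by exists 0 => _ [r _ <-]; apply: unorm_ge0; apply: err_continuous.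
Qed.

Lemma minimax_error_ge n a (M : R) :
  (forall q, (size q <= n.+1)%N -> M <= unorm (err a q)) ->
  M <= minimax_error n a.
Proof.
move=> hM; apply: lb_le_inf; last by move=> _ [q qn <-]; apply: hM.
by exists (unorm (err a 0)), 0 => //; rewrite /deg_le /= size_poly0.
Qed.

Lemma minimax_error_ge0 n a : 0 <= minimax_error n a.
Proof.
by apply: minimax_error_ge => q _; apply: unorm_ge0; apply: err_continuous.
Qed.

Lemma errB a b p q x :
  err a p x - err b q x = `|x - a| - `|x - b| - (p - q).[x].
Proof. by rewrite /err /absf hornerD hornerN; ring. Qed.

Lemma absfB a b x : `| `|x - a| - `|x - b| | <= `|a - b|.
Proof.
apply: (le_trans (ler_dist_dist _ _)).
by rewrite (_ : x - a - (x - b) = b - a); [rewrite distrC|ring].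
Qed.

Lemma minimax_error_lipschitz_le n a b :
  minimax_error n a <= minimax_error n b + `|a - b|.
Proof.
rewrite -lerBlDr; apply: minimax_error_ge => q sq; rewrite lerBlDr.
apply: (le_trans (minimax_error_le a sq)); apply: unorm_le => x x11.
have -> : err a q x = err b q x + (err a q x - err b q x) by ring.
rewrite (le_trans (ler_normD _ _)) // lerD ?le_unorm //.
  exact: err_continuous.
by rewrite errB subrr horner0 subr0 absfB.
Qed.

Lemma minimax_error_lipschitz n a b :
  `|minimax_error n a - minimax_error n b| <= `|a - b|.
Proof.
have h1 := minimax_error_lipschitz_le n a b.
have := minimax_error_lipschitz_le n b a.
rewrite distrC => h2; rewrite ler_norml; apply/andP; split; slra.
Qed.

Lemma minimax_error_continuous n : continuous (@minimax_error R n).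
Proof.
move=> x; apply/cvgrPdist_le => e e0; exists e => //= y /= xy.
by apply: (le_trans (minimax_error_lipschitz n x y)); apply: ltW.
Qed.

(** The substitution [x -> c + (x - a) / s] turns [s] times the distance to [c] into the distance to
    [a], so a candidate for [c] becomes one for [a] of the same degree bound. *)
Lemma minimax_error_scale_le n a c s : 0 < s ->
  (forall x, x \in `[-1, 1] -> c + (x - a) / s \in `[-1, 1]) ->
  minimax_error n a <= s * minimax_error n c.
Proof.
move=> s0 h; rewrite -ler_pdivrMl //; apply: minimax_error_ge => q sq.
rewrite ler_pdivrMl //.
pose r := s *: (q \Po (s^-1%:P * 'X + (c - a / s)%:P)).
have sr : (size r <= n.+1)%N.
  rewrite size_scale ?gt_eqF //.
  apply: (leq_trans (size_comp_poly_leq _ _)).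
  have : (size (s^-1%:P * 'X + (c - a / s)%:P)%R <= 2)%N.
    rewrite size_MXaddC; case: ifP => // _.
    by rewrite ltnS size_polyC leq_b1.
  move: sq; case: (size q) => [|m]; case: (size _) => [|[|[|k]]] //=; nia.
apply: (le_trans (minimax_error_le a sr)); apply: unorm_le => x x11.
have -> : err a r x = s * err c q (c + (x - a) / s).
  rewrite /err /absf hornerZ horner_comp hornerMXaddC hornerC mulrBr.
  congr (_ - s * _.[_]); last by ring.
  rewrite -{1}(gtr0_norm s0) -normrM; congr `|_|; field.
  by rewrite gt_eqF.
rewrite normrM (gtr0_norm s0) ler_pM2l //; apply: le_unorm; last exact: h.
exact: err_continuous.
Qed.

End UniformNorm.

(** * Chebyshev alternation *)

Section Chebyshev.
Variable R : realType.
Implicit Types (n m k : nat) (a b c x y z E : R) (p q : {poly R}).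
Implicit Types (t : nat -> R) (e g : R -> R).

Lemma compact_level e a b v : continuous e ->
  compact ([set x | x \in `[a, b]] `&` e @^-1` [set v]).
Proof.
move=> ec; apply: compact_closedI; first exact: segment_compact.
by move/continuous_closedP: ec; apply; exact: closed_eq.
Qed.

Lemma first_point e a b v : continuous e ->
  (exists2 x, x \in `[a, b] & e x = v) ->
  exists y, [/\ y \in `[a, b], e y = v &
    forall x, x \in `[a, b] -> e x = v -> y <= x].
Proof.
move=> ec [x xab exv].
have [||y] := @compact_EVT_min _ _ (id : R -> R) _ _ (@compact_level e a b v ec).
- by exists x.
- by apply: continuous_subspaceT => u; exact: cvg_id.
rewrite inE => -[yab eyv] ymin; exists y; split=> // u uab euv.
by apply: ymin; rewrite inE.
Qed.

Lemma last_point e a b v : continuous e ->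
  (exists2 x, x \in `[a, b] & e x = v) ->
  exists y, [/\ y \in `[a, b], e y = v &
    forall x, x \in `[a, b] -> e x = v -> x <= y].
Proof.
move=> ec [x xab exv].
have [||y] := @compact_EVT_max _ _ (id : R -> R) _ _ (@compact_level e a b v ec).
- by exists x.
- by apply: continuous_subspaceT => u; exact: cvg_id.
rewrite inE => -[yab eyv] ymin; exists y; split=> // u uab euv.
by apply: ymin; rewrite inE.
Qed.

(** On a compact set [|g|] attains its maximum, which leaves a margin below [E]; on an empty set any
    margin will do. *)
Lemma closed_gap g E (C : set R) : continuous g -> closed C ->
  (forall x, x \in `[-1, 1] -> C x -> `|g x| < E) ->
  exists2 d, 0 < d & forall x, x \in `[-1, 1] -> C x -> `|g x| <= E - d.
Proof.
move=> gc cC gE; pose K := [set x | x \in `[-1, 1 : R]] `&` C.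
have [K0|/set0P/negP/negPn/eqP K0] := pselect (K !=set0); last first.
  by exists 1 => // x x11 Cx; have : K x by []; rewrite K0.
have cK : compact K by apply: compact_closedI => //; exact: segment_compact.
have [|y] := @compact_EVT_max _ _ (fun x => `|g x|) _ K0 cK.
  by apply: continuous_subspaceT; exact: continuous_abs.
rewrite inE => -[y11 Cy] ymax; exists (E - `|g y|).
  by rewrite subr_gt0 gE.
move=> x x11 Cx; rewrite subKr; apply: ymax; by rewrite inE.
Qed.

(** The parity of [k] encodes the sign at the first of the [m + 1] points. *)
Definition alternates e E m k t :=
  increasing_upto m t /\ forall j, (j <= m)%N -> e (t j) = (-1) ^+ (j + k) * E.

(** Induction on [m]: one root is placed between consecutive groups of extremal points of equal
    sign. The last conclusion controls, in the induction step, the polynomial obtained for [y] at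
    the points before [y]. *)
Lemma sign_poly e E m a k : continuous e -> 0 < E -> a <= 1 ->
  e a = (-1) ^+ k * E ->
  (forall t, alternates e E m k t -> t 0%N = a -> 1 < t m) ->
  exists q, [/\ (size q <= m)%N,
    forall x, x \in `[a, 1] -> `|e x| = E -> 0 < q.[x] * e x &
    forall x, x <= a -> 0 < (-1) ^+ k * q.[x]].
Proof.
move=> ec E0.
have sgn2 j : (-1) ^+ j * (-1) ^+ j = 1 :> R by rewrite -expr2 sqrr_sign.
have sgnE j x : `|e x| = E -> e x = (-1) ^+ j * E \/ e x = (-1) ^+ j.+1 * E.
  move=> exE; have : e x = E \/ e x = - E.
    by case: (ger0P (e x)) exE => _ exE; [left|right]; slra.
  by rewrite exprS -signr_odd; case: (odd j); rewrite ?expr0 ?expr1; case; [right|left|left|right]; slra.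
elim: m a k => [|m IH] a k a1 eak noalt.
  suff : 1 < a by rewrite ltNge a1.
  by apply: (noalt (fun=> a)) => //; split=> // j; rewrite leqn0 => /eqP->.
(* Without an extremal point of the opposite sign to the right of [a], a constant suffices. *)
have [ex|nex] := pselect (exists2 x, x \in `[a, 1] & e x = (-1) ^+ k.+1 * E); last first.
  exists ((-1) ^+ k)%:P; split.
  - by rewrite size_polyC; case: (_ != 0).
  - move=> x xa1 exE; rewrite hornerC; case: (sgnE k x exE) => exk.
      by rewrite exk mulrA sgn2 mul1r.
    by case: nex; exists x.
  - by move=> x _; rewrite hornerC sgn2.
have [y [ya1 ey ymin]] := first_point ec ex.
have ay : a < y.
  rewrite lt_neqAle; move: ya1; rewrite in_itv /= => /andP[-> _]; rewrite andbT.
  apply/eqP => ay; have : (-1) ^+ k * E = (-1) ^+ k.+1 * E by rewrite -ey -ay.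
  move=> /(congr1 (fun u => (-1) ^+ k * u)); rewrite exprS mulrA sgn2.
  rewrite mulN1r mulNr mulrN mulrA sgn2; slra.
have y1 : y <= 1 by move: ya1; rewrite in_itv /= => /andP[].
have [|q [sq qS qleft]] := IH y k.+1 y1 ey.
  move=> t [tm te] t0.
  (* An alternation starting at [y] would extend to the left by [a]. *)
  pose t' j := if j is j'.+1 then t j' else a.
  have := noalt t'; rewrite /=; apply => //; split.
    by case=> [|j] jm /=; [rewrite t0|apply: tm].
  by case=> [|j] jm /=; [rewrite add0n|rewrite te // addnS].
(* The extremal points between [a] and [y] all have the sign of [e a] and lie at or before [w], so a
   root between [w] and [y] separates the two groups. *)
have [|w [wa1 ew wmax]] := @last_point e a y ((-1) ^+ k * E) ec.
  by exists a => //; rewrite in_itv /= lexx ltW.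
have wy : w < y.
  move: wa1; rewrite in_itv /= => /andP[_]; rewrite le_eqVlt => /predU1P[wy|//].
  have : (-1) ^+ k * E = (-1) ^+ k.+1 * E by rewrite -ey -wy.
  move=> /(congr1 (fun u => (-1) ^+ k * u)); rewrite exprS mulrA sgn2.
  rewrite mulN1r mulNr mulrN mulrA sgn2; slra.
have aw : a <= w by move: wa1; rewrite in_itv /= => /andP[].
pose z := (w + y) / 2.
have wz : w < z by rewrite /z; slra.
have zy : z < y by rewrite /z; slra.
have qleft' x : x < z -> 0 < (-1) ^+ k * (('X - z%:P) * q).[x].
  move=> xz; have := qleft x ltac:(slra).
  rewrite hornerM hornerXsubC exprS mulN1r => hq.
  by rewrite mulrCA -mulrNN mulr_gt0 //; slra.
exists (('X - z%:P) * q); split.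
- by rewrite (leq_trans (size_polyMleq _ _)) // size_XsubC.
- move=> x xa1 exE.
  have [yx|xy] := leP y x.
    have x1 : x \in `[y, 1] by move: xa1; rewrite !in_itv /= yx => /andP[_ ->].
    rewrite hornerM hornerXsubC -mulrA mulr_gt0 ?qS //; slra.
  have exk : e x = (-1) ^+ k * E.
    case: (sgnE k x exE) => // exk.
    by have := ymin x xa1 exk; slra.
  have xw : x <= w.
    apply: wmax => //; move: xa1; rewrite !in_itv /= => /andP[-> _].
    exact: ltW.
  rewrite exk mulrA [_ * (-1) ^+ k]mulrC mulr_gt0 // qleft' //; slra.
- by move=> x xa; apply: qleft'; slra.
Qed.

(** Otherwise [sign_poly] yields a [q] of degree at most [n] with the sign of the error at all its
    extremal points, and adding a small multiple of [q] to [p] lowers the maximal error. *)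
Theorem chebyshev_alternation n a p :
  (size p <= n.+1)%N -> unorm (err a p) = minimax_error n a ->
  0 < minimax_error n a ->
  exists t k, [/\ alternates (err a p) (minimax_error n a) n.+1 k t,
    -1 <= t 0%N & t n.+1 <= 1].
Proof.
set e := err a p; set E := minimax_error n a => sp pE E0.
have ec : continuous e by exact: err_continuous.
have [x x11 ex] := unorm_attained ec.
(* Starting at the first extremal point makes [sign_poly] cover all of them. *)
have [a0 [a011 ea0 a0min]] := @first_point (fun x => `|e x|) (-1) 1 E
  (continuous_abs ec) (ex_intro2 _ _ x x11 (etrans ex pE)).
have /andP[a0l a0r] : -1 <= a0 <= 1 by move: a011; rewrite in_itv.
have [k ek] : exists k, e a0 = (-1) ^+ k * E.
  move: ea0; case: (ger0P (e a0)) => _ ea0; [exists 0%N|exists 1%N]; rewrite ?expr0 ?expr1; slra.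
apply: contrapT => nalt.
have [|q [sq qS _]] := @sign_poly e E n.+1 a0 k ec E0 a0r ek.
  move=> t talt t0; rewrite ltNge; apply/negP => tn.
  by apply: nalt; exists t, k; split=> //; rewrite t0.
have {}qS y : y \in `[-1, 1] -> `|e y| = E -> 0 < q.[y] * e y.
  move=> y11 eyE; apply: qS => //; have := a0min y y11 eyE.
  by move: y11; rewrite !in_itv /= => /andP[_ ->] ->.
have eE y : y \in `[-1, 1] -> `|e y| <= E by move=> y11; rewrite -pE le_unorm.
have qc : continuous (horner q) by exact: continuous_horner.
have [d d0 dC] : exists2 d, 0 < d & forall y, y \in `[-1, 1] ->
    q.[y] * e y <= 0 -> `|e y| <= E - d.
  apply: (@closed_gap e E [set y | q.[y] * e y <= 0]) => //.
    have hc : continuous (fun y => q.[y] * e y).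
      by move=> y; apply: cvgM; [exact: qc|exact: ec].
    by move/continuous_closedP: hc => /(_ _ (@closed_le R 0)).
  move=> y y11 /= qe; rewrite lt_neqAle eE // andbT; apply/eqP => eyE.
  by have := qS y y11 eyE; rewrite ltNge qe.
pose M := unorm (horner q) + 1.
have M1 : 1 <= M by rewrite /M lerDr unorm_ge0.
(* The perturbation [s * q] stays below [d], the margin available where it has the wrong sign, and
   below [E], so that it does not overshoot where it has the right one. *)
pose s := Num.min d E / (2 * M).
have s0 : 0 < s by rewrite divr_gt0 ?lt_min ?d0 ?E0 //; slra.
have sM : s * M = Num.min d E / 2 by rewrite /s; field; slra.
have sq' : (size (p + s *: q)%R <= n.+1)%N.
  by rewrite (leq_trans (size_polyD _ _)) // geq_max sp (leq_trans (size_scale_leq _ _)).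
have := minimax_error_le a sq'; rewrite -/E.
have [y y11 <-] := unorm_attained (@err_continuous _ a (p + s *: q)).
apply/negP; rewrite -ltNge.
have -> : err a (p + s *: q) y = e y - s * q.[y].
  by rewrite /e /err hornerD hornerZ; ring.
have sqy : `|s * q.[y]| < Num.min d E.
  rewrite normrM gtr0_norm //; apply: (@le_lt_trans _ _ (s * M)).
    by rewrite ler_pM2l // /M; have := le_unorm qc y11; slra.
  by rewrite sM ltr_pdivrMr // ltr_pMr ?lt_min ?d0 ?E0 //; slra.
move: sqy; rewrite lt_min => /andP[sd sE].
have [qe|qe] := leP (q.[y] * e y) 0.
  rewrite (le_lt_trans (ler_normB _ _)) //.
  by have := dC y y11 qe; slra.
have : 0 < (s * q.[y]) * e y by rewrite -mulrA mulr_gt0.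
have := eE y y11; move: sE; set u := s * q.[y]; set v := e y.
rewrite !ltr_norml !ler_norml => /andP[? ?] /andP[? ?] uv.
have [v0|v0] := ltP 0 v.
  have : 0 < u by rewrite -(pmulr_lgt0 _ v0).
  by move=> ?; apply/andP; split; slra.
have : u < 0.
  have v0' : v < 0.
    by rewrite lt_neqAle v0 andbT; apply/eqP => vz; move: uv; rewrite vz mulr0 ltxx.
  by rewrite -(nmulr_lgt0 _ v0').
by move=> ?; apply/andP; split; slra.
Qed.

End Chebyshev.

(** * Existence of minimax polynomials *)

Section Existence.
Variable R : realType.
Implicit Types (n i j : nat) (a y M : R) (p q : {poly R}).

(** Lagrange interpolation; [C] is the sum of the norms of the basis polynomials. *)
Lemma node_bound n (t : nat -> R) : injective t -> exists C : R, 0 <= C /\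
  forall q M, (size q <= n.+1)%N ->
    (forall i, (i <= n)%N -> `|q.[t i]| <= M) ->
    forall y, y \in `[-1, 1] -> `|q.[y]| <= C * M.
Proof.
move=> tinj; pose l (i : 'I_n.+1) : {poly R} := tnth (lagrange n.+1 t) i.
exists (\sum_i unorm (horner (l i))); split.
  by apply: sumr_ge0 => i _; apply: unorm_ge0; exact: continuous_horner.
move=> q M sq qM y y11.
rewrite (lagrange_gen (ltn0Sn n) tinj sq) horner_sum mulr_suml.
apply: (le_trans (ler_norm_sum _ _ _)); apply: ler_sum => i _.
rewrite hornerM hornerC normrM mulrC ler_pM //.
  by apply: le_unorm => //; exact: continuous_horner.
by apply: qM; rewrite -ltnS.
Qed.

(** Polynomials are parametrised by their values at [n + 1] nodes, in which the error norm is
    Lipschitz. It attains a minimum on a compact box, and outside of the box the zero polynomial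
    does at least as well. *)
Theorem minimax_polyP n a : is_minimax n a (minimax_poly n a).
Proof.
suff [p hp] : exists p, is_minimax n a p by exact: (xgetI 0 hp).
pose t i : R := i.+1%:R^-1.
have tinj : injective t.
  by move=> i j /invr_inj /eqP; rewrite eqr_nat eqSS => /eqP.
have t11 i : t i \in `[-1, 1].
  have t0 : 0 <= t i by rewrite invr_ge0.
  have t1 : t i <= 1 by rewrite invf_le1 // ler1n.
  by rewrite in_itv /=; slra.
have [C [C0 Cbound]] := node_bound n tinj.
pose l (i : 'I_n.+1) : {poly R} := tnth (lagrange n.+1 t) i.
pose Q (v : 'rV[R]_n.+1) : {poly R} := \sum_i (v ord0 i)%:P * l i.
have sQ v : (size (Q v) <= n.+1)%N.
  apply: (leq_trans (size_sum _ _ _)); apply/bigmax_leqP => i _.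
  apply: (leq_trans (size_polyMleq _ _)).
  rewrite size_polyC size_lagrange_ //; by case: (_ != 0).
have Qt v i (ni : (i < n.+1)%N) : (Q v).[t i] = v ord0 (Ordinal ni).
  rewrite horner_sum (bigD1 (Ordinal ni)) //= big1 => [|j ij].
    have := lagrange_sample (ltn0Sn n) tinj (Ordinal ni) (Ordinal ni).
    by rewrite eqxx hornerM hornerC => ->; rewrite addr0 mulr1.
  have := lagrange_sample (ltn0Sn n) tinj j (Ordinal ni).
  by rewrite (negbTE ij) hornerM hornerC => ->; rewrite mulr0.
pose F v := unorm (err a (Q v)).
have Flip v w : F v <= F w + C * `|v - w|.
  apply: unorm_le => y y11.
  have -> : err a (Q v) y = err a (Q w) y + (err a (Q v) y - err a (Q w) y) by ring.
  rewrite (le_trans (ler_normD _ _)) // lerD //.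
    by apply: le_unorm => //; exact: err_continuous.
  rewrite errB subrr sub0r normrN; apply: Cbound => // [|i]; last rewrite -ltnS => ni.
    by rewrite (leq_trans (size_polyD _ _)) // geq_max size_polyN !sQ.
  rewrite hornerD hornerN !(Qt _ _ ni).
  have -> : v ord0 (Ordinal ni) - w ord0 (Ordinal ni) = (v - w) ord0 (Ordinal ni).
    by rewrite !mxE.
  rewrite [leRHS]mx_normrE; apply: (@le_trans _ _ `|(v - w) ord0 (Ordinal ni)|) => //.
  exact: (le_bigmax _ (fun ij : 'I_1 * 'I_n.+1 => `|(v - w) ij.1 ij.2|) (ord0, Ordinal ni)).
have Fc : continuous F.
  move=> v; apply/(@cvgrPdist_lt _ _ _ (nbhs v) (nbhs_filter v)) => e e0.
  have d0 : 0 < e / (C + 1) by rewrite divr_gt0 //; slra.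
  have /(@cvgrPdist_lt _ _ _ (nbhs v) (nbhs_filter v))/(_ _ d0) :=
    @cvg_id _ (nbhs v); apply: filterS => w.
  rewrite /= ltr_pdivlMr; last slra.
  move=> vw; have h1 := Flip v w; have := Flip w v; rewrite distrC => h2.
  have : 0 <= `|v - w| by [].
  by move=> ?; rewrite ltr_norml; apply/andP; split; nra.
(* A value above [B] at a node forces an error of at least [B - unorm (err a 0)], which is the error
   of the zero polynomial. *)
pose B := 2 * unorm (err a 0).
pose A := [set v : 'rV[R]_n.+1 |
  forall i : 'I_n.+1, (fun _ : 'I_n.+1 => `[- B, B]%classic) i (v ord0 i)].
have B0 : 0 <= B by rewrite mulr_ge0 // unorm_ge0 //; exact: err_continuous.
have cA : compact A by apply: rV_compact => i; exact: segment_compact.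
have A0 : A 0 by move=> i /=; rewrite mxE in_itv /= B0 oppr_le0 B0.
have [|v vA vmin] := EVT_min_rV (ex_intro _ 0 A0) cA (f := F).
  exact: continuous_subspaceT.
exists (Q v); split; first exact: sQ.
apply/le_anti/andP; split; last exact: minimax_error_le.
apply: minimax_error_ge => q sq.
have [qB|] := pselect (forall i, (i < n.+1)%N -> `|q.[t i]| <= B).
  have -> : q = Q (\row_i q.[t i]).
    rewrite [LHS](lagrange_gen (ltn0Sn n) tinj sq).
    by apply: eq_bigr => i _; rewrite mxE.
  apply: vmin; rewrite inE => i /=.
  by rewrite mxE in_itv /= -ler_norml; apply: qB.
move/existsNP => [i] /not_implyP[ni] /negP; rewrite -ltNge => qB.
have Q0 : Q 0 = 0 by rewrite /Q big1 // => j _; rewrite mxE polyC0 mul0r.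
have := vmin 0; rewrite inE => /(_ A0); rewrite /F Q0 => /le_trans; apply.
have h1 := le_unorm (@err_continuous _ a q) (t11 i).
have h2 := le_unorm (@err_continuous _ a 0) (t11 i).
apply: (le_trans _ h1); move: h2; rewrite /err horner0 subr0 => h2.
have := lerB_dist q.[t i] (absf a (t i)); rewrite distrC => h3.
by apply: (le_trans _ h3); move: qB h2; rewrite /B /err; slra.
Qed.

Lemma size_minimax_poly n a : (size (minimax_poly n a) <= n.+1)%N.
Proof. by case: (minimax_polyP n a). Qed.

Lemma err_minimax_le n a y : y \in `[-1, 1] ->
  `|err a (minimax_poly n a) y| <= minimax_error n a.
Proof.
by move=> y11; case: (minimax_polyP n a) => _ <-; apply: le_unorm => //; exact: err_continuous.
Qed.

End Existence.

(** * Comparison of two alternants *)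

Section Comparison.
Variable R : realType.
Implicit Types (n i j : nat) (a b y M : R) (p q : {poly R}) (t : nat -> R).

(* With [A = 1 / E(a)] and [B = 1 / E(b)], the two sign hypotheses say that the
   affine function [A * (x - a) - B * (x - b)] is nonnegative at -1 and at 1. *)
Lemma gap_sign n a b A B q t P : (0 < n)%N -> a < b -> 0 < A -> 0 < B ->
  0 <= - A * (1 + a) + B * (1 + b) -> 0 <= A * (1 - a) - B * (1 - b) ->
  (size q <= n.+1)%N -> increasing_upto n.+1 t ->
  (forall j, (j <= n.+1)%N -> t j \in `[-1, 1]) -> (P <= n.+2)%N ->
  (forall j, (j <= n.+1)%N -> (j < P)%N -> t j <= a) ->
  (forall j, (j <= n.+1)%N -> (P <= j)%N -> b <= t j) ->
  let D x := A * `|x - a| - B * `|x - b| - q.[x] in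
  (forall j, (j <= n.+1)%N -> (-1) ^+ (j + P) * D (t j) <= 0) ->
  forall j, (j <= n.+1)%N -> D (t j) = 0.
Proof.
(* Writing [n] as a successor makes the order of the divided difference at least 2, as
   [dd_affine_step] requires. *)
case: n => // n _ ab A0 B0 L0 L1 sq tN t11 PN tl tr D Dle.
have alt j : (0 <= j <= 0 + n.+2)%N -> 0 <= (-1) ^+ (j + P.+1) * D (t j).
  by move=> jn; have := Dle j ltac:(nlia); rewrite addnS exprS; slra.
have d1 := @dd_alt _ n.+2 t tN (fun j => D (t j)) n.+2 0 P.+1 (leqnn _) alt.
pose Ls j := ((A - B) * t j + (B * b - A * a)) * step R P j.
(* No node lies strictly between [a] and [b], so at the nodes the difference of absolute values is
   an affine function with a sign flip; the degree of [q] is too small to contribute. *)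
have dE : dd t (fun j => D (t j)) n.+2 0 = dd t Ls n.+2 0.
  rewrite (@eq_dd _ _ _ (fun j => Ls j - q.[t j])).
    by rewrite ddB (dd_poly tN) // subr0.
  move=> j jn; rewrite /D /Ls /step; congr (_ - _).
  case: ltnP => jP.
    have := tl j ltac:(nlia) jP => tja.
    by rewrite !ler0_norm; [ring|slra|slra].
  have := tr j ltac:(nlia) jP => tja.
  by rewrite !ger0_norm; [ring|slra|slra].
have d2 : 0 <= (-1) ^+ (n.+2 + P) * dd t Ls n.+2 0.
  have aff x : x \in `[-1, 1] -> 0 <= (A - B) * x + (B * b - A * a).
    rewrite in_itv /= => /andP[x0 x1].
    have -> : (A - B) * x + (B * b - A * a) =
      ((- A * (1 + a) + B * (1 + b)) * (1 - x) +
       (A * (1 - a) - B * (1 - b)) * (1 + x)) / 2 by field.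
    by rewrite divr_ge0 // addr_ge0 // mulr_ge0 //; slra.
  by apply: (@dd_affine_step _ n.+2 t tN) => //; apply: aff; apply: t11.
(* [d1] and [d2] bound the same number from opposite sides. *)
have d0 : dd t (fun j => D (t j)) n.+2 0 = 0.
  move: d1 d2; rewrite -dE add0n addnS exprS => d1 d2.
  have : (-1) ^+ (n.+2 + P) * dd t (fun j => D (t j)) n.+2 0 = 0 by slra.
  by move/eqP; rewrite mulf_eq0 signr_eq0 /= => /eqP.
move=> j jn.
have := @dd_alt_bound _ n.+2 t tN _ n.+2 0 P.+1 j t11 (leqnn _) alt jn.
by rewrite d0 normr0 mulr0 normr_le0 => /eqP.
Qed.

(** The exponent [P.+1] encodes that the error at the kink [a], the node of rank [P], is [-E]; the
    last clause leaves no alternation points besides the [n + 2] nodes. *)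
Definition alternant n a t P :=
  let e := err a (minimax_poly n a) in let E := minimax_error n a in
  [/\ alternates e E n.+1 P.+1 t, (P <= n.+1)%N, t P = a,
      forall j, (j <= n.+1)%N -> t j \in `[-1, 1] &
      forall x, x \in `[-1, 1] -> `|e x| = E ->
        exists2 j, (j <= n.+1)%N & x = t j].

(* The error of [a], seen from [b], lives on a window rescaled by
   [(1 + b) / (1 + a)]. *)
Lemma minimax_error_ratioL n a b : -1 < a -> a <= b -> b < 1 ->
  minimax_error n b * (1 + a) <= minimax_error n a * (1 + b).
Proof.
move=> a1 ab b1.
have h0 : 0 < (1 + b) / (1 + a) by rewrite divr_gt0; slra.
rewrite -ler_pdivlMr; last slra.
have -> : minimax_error n a * (1 + b) / (1 + a) = (1 + b) / (1 + a) * minimax_error n a by ring.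
apply: minimax_error_scale_le => // x; rewrite !in_itv /= => /andP[x0 x1].
rewrite invf_div.
have -> : a + (x - b) * ((1 + a) / (1 + b)) = -1 + (1 + a) * (1 + x) / (1 + b) by field; slra.
apply/andP; split; first by rewrite lerDl divr_ge0 ?mulr_ge0; slra.
rewrite -lerBrDl ler_pdivrMr; [nra|slra].
Qed.

(** Mirror image of [minimax_error_ratioL]: the rescaling fixes 1 instead of -1. *)
Lemma minimax_error_ratioR n a b : -1 < a -> a <= b -> b < 1 ->
  minimax_error n a * (1 - b) <= minimax_error n b * (1 - a).
Proof.
move=> a1 ab b1.
have h0 : 0 < (1 - a) / (1 - b) by rewrite divr_gt0; slra.
rewrite -ler_pdivlMr; last slra.
have -> : minimax_error n b * (1 - a) / (1 - b) = (1 - a) / (1 - b) * minimax_error n b by ring.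
apply: minimax_error_scale_le => // x; rewrite !in_itv /= => /andP[x0 x1].
rewrite invf_div.
have -> : b + (x - a) * ((1 - b) / (1 - a)) = 1 - (1 - b) * (1 - x) / (1 - a) by field; slra.
apply/andP; split; last by rewrite lerBlDr lerDl divr_ge0 ?mulr_ge0; slra.
rewrite lerBrDr -lerBrDl ler_pdivrMr; [nra|slra].
Qed.

(** If [t' i < t i], the alternants are spliced with a shift by one index between [i] and [P]; the
    shift reverses signs, so that [gap_sign] applies. The normalised errors then agree at all
    spliced nodes, the outer ones from [i] on belong to both alternants, and comparing ranks from
    that end is contradictory. *)
Lemma alternant_mono n a b t t' P i : -1 < a -> a < b -> b < 1 ->
  0 < minimax_error n a -> 0 < minimax_error n b ->
  alternant n a t P -> alternant n b t' P -> (0 < i <= n)%N -> t i <= t' i.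
Proof.
move=> a1 ab b1 Ea0 Eb0 [[tN te] Pn tP t11 tS] [[t'N t'e] _ t'P t'11 t'S].
set ea := err a _ in te tS; set eb := err b _ in t'e t'S.
set Ea := minimax_error n a in te tS Ea0.
set Eb := minimax_error n b in t'e t'S Eb0.
move=> /andP[i0 iN]; rewrite leNgt; apply/negP => ti.
have A0 : 0 < Ea^-1 by rewrite invr_gt0.
have B0 : 0 < Eb^-1 by rewrite invr_gt0.
pose q := Ea^-1 *: minimax_poly n a - Eb^-1 *: minimax_poly n b.
have sq : (size q <= n.+1)%N.
  rewrite (leq_trans (size_polyD _ _)) // geq_max size_polyN.
  by rewrite !(leq_trans (size_scale_leq _ _)) // size_minimax_poly.
pose D x := Ea^-1 * `|x - a| - Eb^-1 * `|x - b| - q.[x].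
have DE x : D x = Ea^-1 * ea x - Eb^-1 * eb x.
  by rewrite /D /q /ea /eb /err /absf hornerD hornerN !hornerZ; ring.
have ea1 x : x \in `[-1, 1] -> `|Ea^-1 * ea x| <= 1.
  move=> x11; rewrite normrM gtr0_norm // ler_pdivrMl // mulr1.
  exact: err_minimax_le.
have eb1 x : x \in `[-1, 1] -> `|Eb^-1 * eb x| <= 1.
  move=> x11; rewrite normrM gtr0_norm // ler_pdivrMl // mulr1.
  exact: err_minimax_le.
have sgn_le k (x : R) : `|x| <= 1 -> (-1) ^+ k * x <= 1 /\ -1 <= (-1) ^+ k * x.
  by rewrite ler_norml -signr_odd => /andP[? ?]; case: (odd k); rewrite ?expr0 ?expr1; split; slra.
have sgn2 k : (-1) ^+ k * (-1) ^+ k = 1 :> R by rewrite -expr2 sqrr_sign.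
have sgnV k (E : R) : 0 < E -> (-1) ^+ k * (E^-1 * (-1 * (-1) ^+ k * E)) = -1.
  move=> E0; have -> : (-1) ^+ k * (E^-1 * (-1 * (-1) ^+ k * E)) =
    - ((-1) ^+ k * (-1) ^+ k) * (E^-1 * E) by ring.
  by rewrite sgn2 mulVf ?mulr1 // gt_eqF.
have tD j : (j <= n.+1)%N -> (-1) ^+ (j + P) * D (t j) <= 0.
  move=> jn; rewrite DE te // addnS exprS.
  have [_ h] := sgn_le (j + P)%N _ (eb1 _ (t11 j jn)).
  by rewrite mulrBr sgnV //; slra.
have t'D j : (j <= n.+1)%N -> 0 <= (-1) ^+ (j + P) * D (t' j).
  move=> jn; rewrite DE t'e // addnS exprS.
  have [_ h] := sgn_le (j + P)%N _ (ea1 _ (t'11 j jn)).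
  by rewrite mulrBr sgnV //; slra.
(* Where [D] vanishes the normalised errors agree, so a point extremal for one is extremal for the
   other. *)
have inS j x : (j <= n.+1)%N -> x \in `[-1, 1] -> D x = 0 ->
    (x = t j -> exists2 m, (m <= n.+1)%N & x = t' m) /\
    (x = t' j -> exists2 m, (m <= n.+1)%N & x = t m).
  move=> jn x11; rewrite DE => /eqP; rewrite subr_eq0 => /eqP eab.
  split=> xE; [apply: t'S => //|apply: tS => //].
    have -> : eb x = Eb * (Ea^-1 * ea x) by rewrite eab mulrA divff ?gt_eqF ?mul1r.
    rewrite xE te // !normrM normrX normrN1 expr1n mul1r normfV.
    by rewrite mulVf ?mulr1 ?gtr0_norm // gt_eqF // normr_gt0 gt_eqF.
  have -> : ea x = Ea * (Eb^-1 * eb x) by rewrite -eab mulrA divff ?gt_eqF ?mul1r.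
  rewrite xE t'e // !normrM normrX normrN1 expr1n mul1r normfV.
  by rewrite mulVf ?mulr1 ?gtr0_norm // gt_eqF // normr_gt0 gt_eqF.
have L0 : 0 <= - Ea^-1 * (1 + a) + Eb^-1 * (1 + b).
  have h := minimax_error_ratioL n a1 (ltW ab) b1.
  have -> : - Ea^-1 * (1 + a) + Eb^-1 * (1 + b) = (Ea * (1 + b) - Eb * (1 + a)) / (Ea * Eb).
    by field; rewrite !gt_eqF.
  by rewrite divr_ge0 ?mulr_ge0 ?subr_ge0 // ltW.
have L1 : 0 <= Ea^-1 * (1 - a) - Eb^-1 * (1 - b).
  have h := minimax_error_ratioR n a1 (ltW ab) b1.
  have -> : Ea^-1 * (1 - a) - Eb^-1 * (1 - b) = (Eb * (1 - a) - Ea * (1 - b)) / (Ea * Eb).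
    by field; rewrite !gt_eqF.
  by rewrite divr_ge0 ?mulr_ge0 ?subr_ge0 // ltW.
have n0 : (0 < n)%N by nlia.
have gap := @gap_sign n a b Ea^-1 Eb^-1 q _ _ n0 ab A0 B0 L0 L1 sq.
have tlt j k : (j < k <= n.+1)%N -> t j < t k by exact: increasing_lt.
have t'lt j k : (j < k <= n.+1)%N -> t' j < t' k by exact: increasing_lt.
have tle j k : (j <= k <= n.+1)%N -> t j <= t k by exact: increasing_le.
have t'le j k : (j <= k <= n.+1)%N -> t' j <= t' k by exact: increasing_le.
have [iP|Pi|iP] := ltngtP i P; last by move: ti; rewrite iP tP t'P; slra.
(* The nodes are [t' 0, ..., t' i, t i, ..., t P.-1, t' P.+1, ..., t' n.+1]: both kinks are left
   out, and the first [P.+1] nodes lie at or before [a]. *)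
- pose u j := if (j <= i)%N then t' j else if (j <= P)%N then t j.-1 else t' j.
  have uD : forall j, (j <= n.+1)%N -> D (u j) = 0.
    apply: (gap u P.+1).
    + move=> j jn; rewrite /u.
      case: (leqP j.+1 i) => ji1; case: (leqP j i) => ji; try nlia.
      * exact: t'N.
      * have -> : j = i by nlia.
        by rewrite iP; exact: ti.
      * case: (leqP j.+1 P) => jP1; case: (leqP j P) => jP; try nlia.
        - by apply: tlt; nlia.
        - have -> : j = P by nlia.
          have := tlt P.-1 P ltac:(nlia); have := t'lt P P.+1 ltac:(nlia).
          by rewrite tP t'P; slra.
        - exact: t'N.
    + by move=> j jn; rewrite /u; do !case: ifP => _; rewrite ?t'11 ?t11 //; nlia.
    + nlia.
    + move=> j jn jP; rewrite /u; case: leqP => ji.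
        have := t'le j i ltac:(nlia); have := tle i P ltac:(nlia); rewrite tP; slra.
      by rewrite ifT -?tP; [apply: tle|]; nlia.
    + move=> j jn jP; rewrite /u ifF ?ifF; [|nlia|nlia].
      by rewrite -t'P; apply: t'le; nlia.
    + move=> j jn; rewrite addnS exprS mulN1r mulNr oppr_le0 -/(D _) /u.
      case: leqP => ji; first exact: t'D.
      case: leqP => jP; last exact: t'D.
      have := tD j.-1 ltac:(nlia); have -> : (j + P = (j.-1 + P).+1)%N by nlia.
      by rewrite exprS mulN1r mulNr oppr_ge0.
  (* The points [t' m] with [m <= i] are nodes of [t] as well; counting from the left, the rank of
     [t' m] in [t] is at least [m]. *)
  suff /(_ i (leqnn i)) : forall m, (m <= i)%N -> t m <= t' m by slra.
  elim=> [|m IH] mi.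
    have := uD 0%N (leq0n _); rewrite /u /= => D0.
    have [_ /(_ erefl) [k kn ->]] := inS 0%N _ (leq0n _) (t'11 0%N (leq0n _)) D0.
    by apply: tle; nlia.
  have := uD m.+1 ltac:(nlia); rewrite /u ifT // => D0.
  have [_ /(_ erefl) [k kn tk]] := inS m.+1 _ ltac:(nlia) (t'11 m.+1 ltac:(nlia)) D0.
  have := t'lt m m.+1 ltac:(nlia); rewrite tk => tmk.
  have : t m < t k by have := IH ltac:(nlia); slra.
  rewrite (increasing_ltE tN) //; last nlia.
  by move=> mk; apply: tle; nlia.
(* The nodes are now [t 0, ..., t P.-1, t' P.+1, ..., t' i, t i, ..., t n.+1], and the first [P] of
   them lie before [a]. *)
- pose u j := if (j < P)%N then t j else if (j < i)%N then t' j.+1 else t j.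
  have uD : forall j, (j <= n.+1)%N -> D (u j) = 0.
    apply: (gap u P).
    + move=> j jn; rewrite /u.
      case: (ltnP j.+1 P) => jP1; case: (ltnP j P) => jP; try nlia.
      * exact: tN.
      * case: (ltnP j.+1 i) => ji1; last by exfalso; nlia.
        have -> : j.+2 = P.+1 by nlia.
        have := tlt j P ltac:(nlia); have := t'lt P P.+1 ltac:(nlia).
        by rewrite tP t'P; slra.
      * case: (ltnP j.+1 i) => ji1; case: (ltnP j i) => ji; try nlia.
        - by apply: t'lt; nlia.
        - by have -> : j.+1 = i by nlia.
        - exact: tN.
    + move=> j jn; rewrite /u; case: ifP => _; rewrite ?t11 //.
      by case: ltnP => ji; rewrite ?t11 ?t'11 //; nlia.
    + nlia.
    + by move=> j jn jP; rewrite /u jP -tP; apply: tle; nlia.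
    + move=> j jn jP; rewrite /u ltnNge jP /= -t'P; case: ltnP => ji.
        by apply: t'le; nlia.
      have := t'le P i ltac:(nlia); have := tle i j ltac:(nlia); slra.
    + move=> j jn; rewrite -/(D _) /u; case: ltnP => jP; first exact: tD.
      case: ltnP => ji; last exact: tD.
      have := t'D j.+1 ltac:(nlia).
      by rewrite addSn exprS mulN1r mulNr oppr_ge0.
  have tin m : (i <= m <= n.+1)%N -> exists2 k, (k <= n.+1)%N & t m = t' k.
    move=> mi; have := uD m ltac:(nlia); rewrite /u ifF ?ifF => [D0||]; try nlia.
    by have [/(_ erefl)] := inS m _ ltac:(nlia) (t11 m ltac:(nlia)) D0.
  (* The same count of ranks, from the right. *)
  have main d : (i <= n.+1 - d)%N -> t (n.+1 - d)%N <= t' (n.+1 - d)%N.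
    elim: d => [|d IH] di.
      have [k kn ->] := tin (n.+1 - 0)%N ltac:(nlia).
      by apply: t'le; nlia.
    have [k kn tk] := tin (n.+1 - d.+1)%N ltac:(nlia).
    rewrite tk; have h := IH ltac:(nlia).
    have : t' k < t' (n.+1 - d)%N.
      rewrite -tk; have := tlt (n.+1 - d.+1)%N (n.+1 - d)%N ltac:(nlia); slra.
    rewrite (increasing_ltE t'N) //; last nlia.
    by move=> kd; apply: t'le; nlia.
  by have := main (n.+1 - i)%N; rewrite subKn; [move=> /(_ (leqnn _)); slra|nlia].
Qed.

End Comparison.

(** * Extremal points of the error *)

Section ExtremalPoints.
Variable R : realType.
Implicit Types (n i j k : nat) (a b x y z : R) (p q : {poly R}) (t : nat -> R).

Lemma poly_itv_eq0 q x y : x < y ->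
  (forall z, z \in `]x, y[ -> q.[z] = 0) -> q = 0.
Proof.
move=> xy q0; pose f i : R := x + (y - x) * (i.+2%:R)^-1.
have finj : injective f.
  move=> i j /addrI /mulfI h.
  have /h /invr_inj /eqP : y - x != 0 by rewrite gt_eqF // subr_gt0.
  by rewrite eqr_nat !eqSS => /eqP.
apply: (@poly_ltsp_roots _ _ (mkseq f (size q))); first by rewrite size_mkseq.
  by rewrite mkseq_uniq.
apply/allP => _ /mapP [i _ ->]; apply/rootP/q0.
have i0 : 0 < (i.+2%:R : R)^-1 by rewrite invr_gt0.
have i1 : (i.+2%:R : R)^-1 < 1 by rewrite invf_lt1 // ltr1n.
have yx : 0 < y - x by rewrite subr_gt0.
rewrite in_itv /= /f ltrDl mulr_gt0 //= -ltrBrDl.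
by rewrite gtr_pMr.
Qed.

(** A one-sided Fermat rule, needed at the kink, where each polynomial branch of the error is
    available on one side only. *)
Lemma deriv_le0_right q x y : x < y ->
  (forall z, z \in `[x, y] -> q.[z] <= q.[x]) -> q^`().[x] <= 0.
Proof.
move=> xy qmax; rewrite leNgt; apply/negP => q0.
have [d d0 dP] := poly_cont x q^`() q0.
have [z [xz zd zy]] : exists z, [/\ x < z, z <= x + d / 2 & z <= y].
  exists (Num.min y (x + d / 2)); rewrite lt_min xy !ge_min !lexx orbT.
  by split=> //=; slra.
have [c] := poly_mvt q xz; rewrite in_itv /= => /andP[xc cz] qz.
have qxz : q.[z] <= q.[x] by apply: qmax; rewrite in_itv /= ltW.
have /dP : `|c - x| < d by rewrite gtr0_norm; slra.
rewrite ltr_norml => /andP[qc _].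
have : 0 < q^`().[c] * (z - x) by rewrite mulr_gt0; slra.
slra.
Qed.

Lemma deriv_ge0_left q x y : x < y ->
  (forall z, z \in `[x, y] -> q.[z] <= q.[y]) -> 0 <= q^`().[y].
Proof.
move=> xy qmax; have xy' : - y < - x by slra.
have := @deriv_le0_right (q \Po (- 'X)) _ _ xy'.
rewrite deriv_comp derivN derivX !hornerE !horner_comp !hornerE opprK.
move=> h; suff : q^`().[y] * (-1) <= 0 by slra.
apply: h => z; rewrite in_itv /= => /andP[yz zx].
rewrite !horner_comp !hornerE; apply: qmax; rewrite in_itv /=; apply/andP; split; slra.
Qed.

(** A polynomial equal to [|x - a|] on [-1, 1] would be [x - a] identically, which is wrong at
    -1. *)
Lemma minimax_error_gt0 n a : -1 < a -> a < 1 -> 0 < minimax_error n a.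
Proof.
move=> a1 a2; rewrite lt_neqAle minimax_error_ge0 andbT eq_sym; apply/eqP => E0.
set p := minimax_poly n a.
have pE x : x \in `[-1, 1] -> p.[x] = `|x - a|.
  move=> x11; have := err_minimax_le n a x11.
  by rewrite E0 normr_le0 /err /absf subr_eq0 => /eqP.
have pX : p - ('X - a%:P) = 0.
  apply: (poly_itv_eq0 a2) => z; rewrite in_itv /= => /andP[az z1].
  rewrite hornerD hornerN hornerXsubC pE ?gtr0_norm ?in_itv /=; slra.
have := pE (-1); rewrite in_itv /= lexx => /(_ ltac:(slra)).
by rewrite -[p]subr0 -pX opprB addrC subrK hornerXsubC ler0_norm; slra.
Qed.

(** * Critical points and kink of the error for a fixed [a] *)

Section Structure.
Variables (n : nat) (a : R).
Hypotheses (a1 : -1 < a) (a2 : a < 1).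
Let p := minimax_poly n a.
Let e := err a p.
Let E := minimax_error n a.
(** [eL] and [eR] are the polynomial branches of the error on the two sides of the kink, to which
    Rolle's theorem and the mean value theorem apply. *)
Let eL : {poly R} := a%:P - 'X - p.
Let eR : {poly R} := 'X - a%:P - p.
Let slope x : R := if x < a then -1 else 1.
Let S x := x \in `[-1, 1] /\ `|e x| = E.

Let E0 : 0 < E. Proof. exact: minimax_error_gt0. Qed.
Let sp : (size p <= n.+1)%N. Proof. exact: size_minimax_poly. Qed.
Let sp' : (size p^`() <= n)%N.
Proof.
have [->|p0] := eqVneq p 0; first by rewrite deriv0 size_poly0.
by rewrite -ltnS; apply: leq_trans sp; apply: lt_size_deriv.
Qed.

Let eLE x : x <= a -> eL.[x] = e x.
Proof.
by move=> xa; rewrite /eL /e /err /absf !hornerE ler0_norm; lra.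
Qed.

Let eRE x : a <= x -> eR.[x] = e x.
Proof.
by move=> xa; rewrite /eR /e /err /absf !hornerE ger0_norm; lra.
Qed.

Let deL x : eL^`().[x] = -1 - p^`().[x].
Proof. by rewrite /eL !derivB derivC derivX !hornerD !hornerN hornerC hornerC; ring. Qed.

Let deR x : eR^`().[x] = 1 - p^`().[x].
Proof. by rewrite /eR !derivB derivC derivX !hornerD !hornerN !hornerC; ring. Qed.

Let eE x : x \in `[-1, 1] -> `|e x| <= E. Proof. exact: err_minimax_le. Qed.

Lemma extremal_critical x : x \in `]-1, 1[ -> x != a -> S x ->
  p^`().[x] = slope x.
Proof.
rewrite in_itv /= => /andP[x1 x2] xa [x11 exE].
have [s s1 sx] : exists2 s : R, s = 1 \/ s = -1 & s * e x = E.
  move: exE; case: (ger0P (e x)) => _ <-.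
    by exists 1; [left|rewrite mul1r].
  by exists (-1); [right|rewrite mulN1r].
have smax z : z \in `[-1, 1] -> s * e z <= s * e x.
  move=> z11; rewrite sx; have := eE z11; rewrite ler_norml => /andP[? ?].
  by case: s1 => ->; lra.
have main (q : {poly R}) y z : y < x -> x < z ->
    (forall u, u \in `[y, z] -> u \in `[-1, 1] /\ q.[u] = e u) -> q^`().[x] = 0.
  move=> yx xz qe.
  have qeu u : u \in `[y, z] -> (s *: q).[u] <= (s *: q).[x].
    move=> uyz; have xyz : x \in `[y, z] by rewrite in_itv /= !ltW.
    rewrite !hornerZ (qe u uyz).2 (qe x xyz).2.
    by apply: smax; case: (qe u uyz).
  have h1 : (s *: q)^`().[x] <= 0.
    apply: (deriv_le0_right xz) => u; rewrite in_itv /= => /andP[xu uz].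
    by apply: qeu; rewrite in_itv /= uz (le_trans (ltW yx)).
  have h2 : 0 <= (s *: q)^`().[x].
    apply: (deriv_ge0_left yx) => u; rewrite in_itv /= => /andP[yu ux].
    by apply: qeu; rewrite in_itv /= yu (le_trans ux) // ltW.
  by move: h1 h2; rewrite derivZ hornerZ; case: s1 => ->; lra.
rewrite /slope; case: ltP => xa'.
  have := main eL (-1) a x1 xa'; rewrite deL => h.
  have {}h : -1 - p^`().[x] = 0; last lra.
  apply: h => u; rewrite in_itv /= => /andP[u1 ua].
  split; last by rewrite eLE.
  by rewrite in_itv /=; apply/andP; split; move: a2; lra.
have ax : a < x by rewrite lt_neqAle eq_sym xa.
have := main eR a 1 ax x2; rewrite deR => h.
have {}h : 1 - p^`().[x] = 0; last lra.
apply: h => u; rewrite in_itv /= => /andP[u1 ua].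
split; last by rewrite eRE.
by rewrite in_itv /=; apply/andP; split; move: a1; lra.
Qed.

Variables (t : nat -> R) (k : nat).
Hypotheses (talt : alternates e E n.+1 k t).
Hypotheses (t11 : forall j, (j <= n.+1)%N -> t j \in `[-1, 1]).

(* Otherwise [e] would be monotone, and could not alternate three times. *)
Lemma deriv_minimax_poly_neq (c : R) : c = 1 \/ c = -1 -> p^`() <> c%:P.
Proof.
move=> c1 pc.
have c0 : c != 0 by case: c1 => ->; rewrite ?oppr_eq0 oner_eq0.
(* A nonzero derivative requires [n > 0], which supplies the three nodes [t 0], [t 1], [t 2]. *)
have n0 : (0 < n)%N.
  by apply: leq_trans sp'; rewrite pc size_polyC c0.
have [tN te] := talt.
have pcE x y : x < y -> p.[y] - p.[x] = c * (y - x).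
  by move=> xy; have [z _ ->] := poly_mvt p xy; rewrite pc hornerC.
have eB x y : x < y -> 0 <= c * (e x - e y).
  move=> xy; have := pcE _ _ xy; rewrite /e /err /absf => pxy.
  have -> : `|x - a| - p.[x] - (`|y - a| - p.[y]) = `|x - a| - `|y - a| + c * (y - x).
    by rewrite -pxy; ring.
  have := absfB x y a; rewrite -(distrC a x) -(distrC a y).
  rewrite (ltr0_norm (_ : x - y < 0)) ?subr_lt0 // ler_norml => /andP[? ?].
  by case: c1 => ->; lra.
have t01 : t 0%N < t 1%N by apply: tN.
have t12 : t 1%N < t 2%N by apply: tN; nlia.
have := eB _ _ t01; have := eB _ _ t12.
rewrite !te //.
rewrite add0n add1n add2n !exprS -signr_odd.
by case: (odd k); rewrite ?expr0 ?expr1; case: c1 => ->; move: E0; lra.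
Qed.

Lemma sorted_nodes (s : seq R) m : uniq s -> (m < size s)%N ->
  increasing_upto m (nth 0 (sort <=%R s)).
Proof.
move=> us ms j jm.
have ss : sorted <%R (sort <=%R s).
  by rewrite lt_sorted_uniq_le sort_uniq us sort_le_sorted.
apply: (sorted_ltn_nth lt_trans) => //; rewrite inE size_sort.
  exact: ltn_trans jm ms.
exact: leq_ltn_trans jm ms.
Qed.

Lemma step_nodes (u : nat -> R) m P :
  (forall j, (j <= m)%N -> (j < P)%N = (u j < a)) ->
  forall j, (j <= m)%N -> step R P j = slope (u j).
Proof. by move=> uP j jm; rewrite /step /slope uP. Qed.

Lemma node_threshold (u : nat -> R) m : increasing_upto m u ->
  exists2 P, (P <= m.+1)%N & forall j, (j <= m)%N -> (j < P)%N = (u j < a).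
Proof.
elim: m => [|m IH] um.
  case: (ltP (u 0%N) a) => ua; [exists 1%N|exists 0%N] => // j;
    by rewrite leqn0 => /eqP->; rewrite ?ua // ltNge ua.
have [|P Pm PP] := IH; first by move=> j jm; apply: um; nlia.
case: (ltP (u m.+1) a) => ua.
  exists m.+2 => // j jm; rewrite ltnS jm; apply/esym.
  by apply: le_lt_trans ua; apply: (increasing_le um); rewrite jm leqnn.
exists P => [|j]; first by nlia.
rewrite leq_eqVlt => /predU1P[->|jm]; last exact: PP.
by rewrite ltNge ua ltnNge Pm.
Qed.

(** The derivative minus [c] has too many roots. The list is nonempty for the sake of [n = 0], where
    the constant [c] still has size 1. *)
Lemma critical_const (s : seq R) c : uniq s -> (c = 1 \/ c = -1) ->
  (0 < size s)%N -> (n <= size s)%N ->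
  (forall x, x \in s -> p^`().[x] = c) -> False.
Proof.
move=> us c1 s0 sn sc; apply: (deriv_minimax_poly_neq c1).
apply/eqP; rewrite -subr_eq0; apply/eqP.
apply: (@poly_ltsp_roots _ _ s) => //.
  rewrite (leq_trans (size_polyD _ _)) // geq_max size_polyN (leq_trans sp') //.
  by rewrite (leq_trans (size_polyC_leq1 _)).
by apply/allP => x xs; apply/rootP; rewrite hornerD hornerN hornerC sc // subrr.
Qed.

(** At [n + 1] such points the sign function would share its divided difference of order [n] with
    the derivative of [p], so that it would vanish, against [dd_step]. If all the points lie on one
    side of [a] there is no jump, and [critical_const] takes over. *)
Lemma size_critical (s : seq R) : uniq s ->
  (forall x, x \in s -> p^`().[x] = slope x) -> (size s <= n)%N.
Proof.
move=> us sc; rewrite leqNgt; apply/negP => ns.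
pose u := nth 0 (sort <=%R s).
have un : increasing_upto n u by exact: sorted_nodes.
have uc j : (j <= n)%N -> p^`().[u j] = slope (u j).
  by move=> jn; apply: sc; rewrite -(mem_sort <=%R) mem_nth // size_sort; exact: leq_ltn_trans jn ns.
have [P Pn PP] := node_threshold un.
have us' : uniq (mkseq u n.+1).
  apply/(uniqP 0) => i j; rewrite !inE size_mkseq => iN jN.
  by rewrite !nth_mkseq //; apply: (increasing_inj un).
have cst c : c = 1 \/ c = -1 -> (forall j, (j <= n)%N -> slope (u j) = c) -> False.
  move=> c1 uc'; apply: (critical_const us' c1); rewrite ?size_mkseq //.
  move=> x /mapP[j]; rewrite mem_iota => /andP[_ jn] ->.
  by rewrite uc ?uc' //; nlia.
have [P0|P0] := posnP P.
  apply: (cst 1); first by left.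
  by move=> j jn; rewrite /slope -PP // P0.
have [Pn'|Pn'] := ltnP n P.
  apply: (cst (-1)); first by right.
  by move=> j jn; rewrite /slope -PP // ifT //; nlia.
have n0 : (0 < n)%N by nlia.
have := dd_poly un sp' (leqnn (0 + n)%N).
rewrite (@eq_dd _ _ _ (step R P)); last first.
  by move=> j jn; rewrite uc // (step_nodes PP).
case: (n) n0 un Pn' => // m _ um Pm d0.
have [_ h] := @dd_step _ m.+1 u um m P 0 (leqnn _).
by have := h ltac:(nlia); rewrite d0 mulr0 ltxx.
Qed.

(** The points to which [extremal_critical] does not apply: the two ends and the kink. *)
Let exceptional : seq R := [:: -1; a; 1].

Lemma extremal_filter (s : seq R) : uniq s -> (forall x, x \in s -> S x) ->
  let s' := [seq x <- s | x \notin exceptional] in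
  [/\ uniq s', forall x, x \in s' -> p^`().[x] = slope x &
      (size s <= size s' + size [seq x <- s | x \in exceptional])%N].
Proof.
move=> us sS s'; split; first exact: filter_uniq.
  move=> x; rewrite mem_filter !inE !negb_or => /andP[/and3P[x1 xa x2] xs].
  have [x11 exE] := sS x xs; apply: extremal_critical => //.
  move: x11; rewrite !in_itv /= !le_eqVlt => /andP[].
  by rewrite eq_sym (negbTE x1) (negbTE x2) /= => -> ->.
by rewrite !size_filter addnC count_predC.
Qed.

(** At most [n] of the points are critical, so two exceptional points other than [a] must occur. *)
Lemma exceptional_mem (s : seq R) : uniq s -> (forall x, x \in s -> S x) ->
  (n.+2 <= size s)%N -> a \notin s ->
  [/\ -1 \in s, 1 \in s & size s = n.+2].
Proof.
move=> us sS ns aNs.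
have [us' sc ss] := extremal_filter us sS.
have sn := size_critical us' sc.
have usx : uniq [seq x <- s | x \in exceptional] by exact: filter_uniq.
have sub1 : {subset [seq x <- s | x \in exceptional] <= [:: -1; 1]}.
  move=> x; rewrite mem_filter !inE => /andP[/or3P[->|/eqP xa|->] xs] //.
    by move: aNs; rewrite -xa xs.
  by rewrite orbT.
have s2 := uniq_leq_size usx sub1; rewrite /= in s2.
have memx y : y \in [:: -1; 1 : R] -> y \in s.
  move=> y1; apply/negPn/negP => yNs.
  have sub2 : {subset [seq x <- s | x \in exceptional] <= rem y [:: -1; 1]}.
    move=> x xs; rewrite mem_rem_uniq.
      rewrite inE sub1 // andbT; apply/eqP => xy.
      by move: xs; rewrite mem_filter xy (negbTE yNs) andbF.
    by rewrite /= inE andbT -subr_eq0 lt_eqF //; lra.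
  have := uniq_leq_size usx sub2; rewrite size_rem //= => s1.
  have key (u v w m : nat) :
    (m.+2 <= u -> u <= v + w -> v <= m -> w <= 1 -> False)%N by nlia.
  exact: key ns ss sn s1.
split; [by apply: memx; rewrite inE eqxx|by apply: memx; rewrite !inE eqxx orbT|].
have key (u v w m : nat) :
  (m.+2 <= u -> u <= v + w -> v <= m -> w <= 2 -> u = m.+2)%N by nlia.
exact: key ns ss sn s2.
Qed.

Lemma extremal_sign x : S x -> exists k, e x = (-1) ^+ k * E.
Proof.
case=> _; case: (ger0P (e x)) => _ exE; [exists 0%N|exists 1%N].
  by rewrite expr0 mul1r.
by rewrite expr1 mulN1r; lra.
Qed.

Lemma extremal_opp x y : S x -> S y -> e x <> e y -> e y = - e x.
Proof.
move=> [_ xE] [_ yE] /eqP xy; move: xE yE xy.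
by case: (ger0P (e x)) => _ <-; case: (ger0P (e y)) => _ yE /eqP xy; try lra; case: xy; lra.
Qed.

(** Of [n + 3] extremal points at least [n] are critical. Two neighbours with equal errors would
    give, by Rolle's theorem, one more critical point in between, contrary to [size_critical]. *)
Lemma alternation_of_many (s : seq R) : uniq s -> (forall x, x \in s -> S x) ->
  size s = n.+3 -> exists u k', alternates e E n.+2 k' u /\
    forall j, (j <= n.+2)%N -> u j \in `[-1, 1].
Proof.
move=> us sS sn.
have key (u v w m : nat) : (u = m.+3 -> u <= v + w -> w <= 3 -> m <= v)%N by nlia.
have as' : a \in s.
  apply/negPn/negP => aNs; have [|_ _] := exceptional_mem us sS _ aNs; rewrite sn //.
  by move=> /eqP; rewrite eqn_leq ltnn.
have [us' sc ss] := extremal_filter us sS.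
have usx : uniq [seq x <- s | x \in exceptional] by exact: filter_uniq.
have sub1 : {subset [seq x <- s | x \in exceptional] <= exceptional}.
  by move=> x; rewrite mem_filter => /andP[].
have := key _ _ _ _ sn ss (uniq_leq_size usx sub1) => ns'.
pose u := nth 0 (sort <=%R s).
have un : increasing_upto n.+2 u by apply: sorted_nodes => //; rewrite sn.
have us_ j : (j <= n.+2)%N -> u j \in s.
  by move=> jn; rewrite -(mem_sort <=%R) mem_nth // size_sort sn.
have uidx x : x \in s -> exists2 j, (j <= n.+2)%N & x = u j.
  rewrite -(mem_sort <=%R) => /(nthP 0)[j]; rewrite size_sort sn => jn <-.
  by exists j.
have alt j : (j < n.+2)%N -> e (u j.+1) = - e (u j).
  move=> jn; apply: extremal_opp; [exact/sS/us_/ltnW|exact/sS/us_|] => eu.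
  have uj : u j < u j.+1 by exact: un.
  have gap x : x \in s -> ~~ (u j < x < u j.+1).
    move=> /uidx[i ni ->]; rewrite !(increasing_ltE un) //; [nlia|exact: ltnW].
  have [c cj c'] : exists2 c, u j < c < u j.+1 & p^`().[c] = slope c.
    (* The kink is among the points, so it does not separate neighbours and a single branch covers
       the gap. *)
    have [au|ua] : a <= u j \/ u j.+1 <= a.
      by have := gap a as'; rewrite negb_and -!leNgt => /orP[]; [left|right].
      have [|c] := @poly_rolle _ (u j) (u j.+1) eR uj.
        by rewrite !eRE //; lra.
      rewrite in_itv /= deR => /andP[c1 c2] c'; exists c; rewrite ?c1 //.
      by rewrite /slope ifF; [lra|apply/negbTE; rewrite -leNgt; lra].
    have [|c] := @poly_rolle _ (u j) (u j.+1) eL uj.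
      by rewrite !eLE //; lra.
    rewrite in_itv /= deL => /andP[c1 c2] c'; exists c; rewrite ?c1 //.
    by rewrite /slope ifT; lra.
  have cNs : c \notin s by apply/negP => /gap; rewrite cj.
  have := @size_critical (c :: [seq x <- s | x \notin exceptional]).
  rewrite /= us' andbT mem_filter (negbTE cNs) andbF => /(_ isT) h.
  have : ((size [seq x <- s | x \notin exceptional]).+1 <= n)%N.
    by apply: h => x; rewrite inE => /predU1P[->//|]; exact: sc.
  by rewrite ltnNge ns'.
have [k' uk] := extremal_sign (sS _ (us_ 0%N (leq0n _))).
exists u, k'; split; last by move=> j jn; case: (sS _ (us_ j jn)).
split=> // j; elim: j => [_|j IH jn]; first by rewrite add0n.
by rewrite alt // IH 1?ltnW // addSn exprS mulN1r mulNr.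
Qed.

Lemma alternation_extremal j : (j <= n.+1)%N -> S (t j).
Proof.
move=> jn; split; first exact: t11.
have [_ te] := talt.
by rewrite te // normrM normrX normrN1 expr1n mul1r gtr0_norm.
Qed.

Lemma mem_nodes x : reflect (exists2 j, (j <= n.+1)%N & x = t j) (x \in mkseq t n.+2).
Proof.
apply: (iffP mapP) => -[j jn ->]; exists j => //.
  by move: jn; rewrite mem_iota.
by rewrite mem_iota.
Qed.

Lemma uniq_nodes : uniq (mkseq t n.+2).
Proof.
have [tN _] := talt.
apply/(uniqP 0) => i j; rewrite !inE size_mkseq => iN jN.
by rewrite !nth_mkseq //; apply: (increasing_inj tN).
Qed.

Hypothesis not_many : forall u k', alternates e E n.+2 k' u ->
  (forall j, (j <= n.+2)%N -> u j \in `[-1, 1]) -> False.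

(** One more extremal point would make [n + 3], and by [alternation_of_many] these would
    alternate. *)
Lemma extremal_mem_nodes x : S x -> x \in mkseq t n.+2.
Proof.
move=> Sx; apply/negPn/negP => xNt.
have us : uniq (x :: mkseq t n.+2) by rewrite cons_uniq xNt uniq_nodes.
have sS y : y \in x :: mkseq t n.+2 -> S y.
  by rewrite inE => /predU1P[->//|/mem_nodes[j jn ->]]; exact: alternation_extremal.
have [|u [k' [ualt u11]]] := alternation_of_many us sS.
  by rewrite [size _]/= size_map size_iota.
exact: not_many ualt u11.
Qed.

(** If [a] is not a node, then -1 and 1 are nodes and the [n] inner nodes are critical. The error
    exceeds [-E] at [a] and equals [-E] at one of the neighbouring nodes, so in between the
    derivative deviates from critical in a known direction. Together with the inner nodes this
    contradicts the sign in [dd_step]. *)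
Lemma alternation_mem_kink : a \in mkseq t n.+2.
Proof.
have [tN te] := talt.
apply/negPn/negP => aNt.
have tS x : x \in mkseq t n.+2 -> S x.
  by move=> /mem_nodes[j jn ->]; exact: alternation_extremal.
have := exceptional_mem uniq_nodes tS; rewrite size_mkseq => /(_ (leqnn _) aNt).
move=> [/mem_nodes[j0 j0n tj0] /mem_nodes[j1 j1n tj1] _].
have aNj j : (j <= n.+1)%N -> t j != a.
  by move=> jn; apply: contraNneq aNt => <-; apply/mem_nodes; exists j.
have t0a : t 0%N < a.
  apply: le_lt_trans a1; rewrite tj0; exact: (increasing_le tN).
have atn : a < t n.+1.
  apply: (lt_le_trans a2); rewrite tj1; apply: (increasing_le tN).
  by rewrite j1n leqnn.
have [P Pn PP] := node_threshold tN.
have P0 : (0 < P)%N by rewrite PP.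
have Pn' : (P <= n.+1)%N.
  rewrite leqNgt; apply/negP => nP; have := PP n.+1 (leqnn _).
  by rewrite nP ltNge ltW.
have tPa : t P.-1 < a by rewrite -PP; nlia.
have atP : a < t P.
  rewrite lt_neqAle eq_sym aNj //= leNgt -PP //; nlia.
have tcrit j : (0 < j <= n)%N -> p^`().[t j] = slope (t j).
  move=> jn; apply: extremal_critical; last by apply: alternation_extremal; nlia.
    have := @t11 0%N (leq0n _); have := @t11 n.+1 (leqnn _); rewrite !in_itv /=.
    have := increasing_lt (i := 0) (j := j) tN ltac:(nlia).
    have := increasing_lt (i := j) (j := n.+1) tN ltac:(nlia).
    by move=> h1 h2 /andP[? ?] /andP[? ?]; apply/andP; split; lra.
  by apply: aNj; nlia.
have tinj (s : seq nat) : uniq s -> (forall j, j \in s -> (j <= n.+1)%N) -> uniq (map t s).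
  move=> us sn; rewrite map_inj_in_uniq // => i j /sn iN /sn jN.
  exact: (increasing_inj tN).
have a11 : a \in `[-1, 1] by rewrite in_itv /= !ltW.
have ea_lt : `|e a| < E.
  rewrite lt_neqAle eE // andbT; apply/eqP => eaE.
  by have := @extremal_mem_nodes a (conj a11 eaE); rewrite (negbTE aNt).
have gapx x Q : t P.-1 < x < t P -> x != a -> Q = (P.-1 + (x < a)%R)%N ->
    (0 < Q <= n)%N -> (-1) ^+ (P.-1 + Q) * (slope x - p^`().[x]) <= 0 -> False.
  move=> /andP[x1 x2] xa QE Qn sx.
  (* The inner nodes with [x] inserted between [t P.-1] and [t P]; [Q] of them lie to the left of
     [a]. *)
  pose u j := if (j < P.-1)%N then t j.+1 else if j == P.-1 then x else t j.
  have un : increasing_upto n u.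
    move=> j jn; rewrite /u.
    case: (ltnP j P.-1) => ji.
      case: (ltnP j.+1 P.-1) => ji1; first by apply: tN; nlia.
      have jE : j.+1 = P.-1 by nlia.
      by rewrite jE eqxx.
    rewrite ltnNge leqW //= [j.+1 == _]gtn_eqF //.
    case: eqVneq => [jE|jE]; last by apply: tN; nlia.
    by have -> : j.+1 = P by nlia.
  have uQ j : (j <= n)%N -> (j < Q)%N = (u j < a).
    move=> jn; rewrite /u; case: (ltnP j P.-1) => ji.
      by rewrite -PP ?QE; [case: (x < a); nlia|nlia].
    case: eqVneq => [->|jE]; first by rewrite QE; case: (x < a) => /=; nlia.
    rewrite -PP; last nlia.
    by rewrite QE; case: (x < a) => /=; nlia.
  (* Nonzero at [x] at most, since the inner nodes are critical. *)
  pose g j := step R Q j - p^`().[u j].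
  have g0 j : (0 <= j <= 0 + n)%N -> 0 <= (-1) ^+ (j + Q.+1) * g j.
    move=> /andP[_ jn]; rewrite addnS exprS mulN1r mulNr oppr_ge0 /g.
    rewrite (step_nodes uQ) // /u; case: (ltnP j P.-1) => ji.
      by rewrite tcrit ?subrr ?mulr0 //; nlia.
    case: eqVneq => [->//|jE].
    by rewrite tcrit ?subrr ?mulr0 //; nlia.
  have := dd_alt un (leqnn (0 + n)%N) g0.
  rewrite ddB (dd_poly un sp') // subr0 addnS exprS mulN1r mulNr oppr_ge0 leNgt.
  case: (n) Qn un => [|m] Qn um; first by nlia.
  have [_ h] := @dd_step _ m.+1 u um m Q 0 (leqnn _).
  by rewrite h.
have const0 c : n = 0%N -> p^`().[c] = 0.
  by move=> n0; move: sp'; rewrite n0 leqn0 size_poly_eq0 => /eqP->; rewrite horner0.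
(* Covers the case of all inner nodes on one side of [a], in which the sign function has no jump to
   exploit. *)
have allcrit c : c = 1 \/ c = -1 -> (0 < n)%N ->
    (forall j, (0 < j <= n)%N -> slope (t j) = c) -> False.
  move=> c1 n0 tc; have us : uniq (map t (iota 1 n)).
    by apply: tinj; [exact: iota_uniq|move=> j; rewrite mem_iota; nlia].
  apply: (critical_const us c1); rewrite ?size_map ?size_iota //.
  move=> x /mapP[j]; rewrite mem_iota add1n ltnS => jn ->.
  by rewrite tcrit // tc.
move: ea_lt; rewrite ltr_norml => /andP[eaE _].
have SP := @alternation_extremal P Pn'.
have SP1 := @alternation_extremal P.-1 ltac:(nlia).
have eP : e (t P) = - e (t P.-1).
  rewrite !te //; last nlia.
  have -> : (P + k = (P.-1 + k).+1)%N by nlia.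
  by rewrite exprS mulN1r mulNr.
(* The neighbours of [a] have opposite errors: the error rises from [-E] towards [a], or falls from
   [a] to [-E]. *)
have [eP1|eP2] : e (t P.-1) = - E \/ e (t P) = - E.
  have [_] := SP1; case: (ger0P (e (t P.-1))) => _ eE'; [right|left]; lra.
  have [c] := @poly_mvt _ (t P.-1) a eL tPa.
  rewrite in_itv /= deL !eLE ?lexx ?(ltW tPa) // => /andP[c1 c2] ec.
  have c0 : 0 < -1 - p^`().[c].
    by rewrite -(pmulr_lgt0 _ (_ : 0 < a - t P.-1)) ?subr_gt0 // -ec; lra.
  have [PEn|PEn] := leqP P n.
    apply: (gapx c P) => //.
    - by rewrite c1 /=; lra.
    - by rewrite lt_eqF.
    - by rewrite c2; nlia.
    - by rewrite P0 PEn.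
    - have -> : (P.-1 + P = (P.-1 + P.-1).+1)%N by nlia.
      by rewrite exprS addnn -muln2 exprM sqrr_sign /slope c2; lra.
  have [n0|n0] := posnP n; first by move: c0; rewrite const0 //; lra.
  apply: (allcrit (-1)); [by right|done|move=> j jn].
  by rewrite /slope -PP ?ifT //; nlia.
have [c] := @poly_mvt _ a (t P) eR atP.
rewrite in_itv /= deR !eRE ?lexx ?(ltW atP) // => /andP[c1 c2] ec.
have c0 : 1 - p^`().[c] < 0.
  by rewrite -(pmulr_llt0 _ (_ : 0 < t P - a)) ?subr_gt0 // -ec; lra.
have cNa : (c < a) = false by apply/negbTE; rewrite -leNgt ltW.
have [P1|P1] := ltnP 0 P.-1.
  apply: (gapx c P.-1) => //.
  - by rewrite c2 andbT; lra.
  - by rewrite gt_eqF.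
  - by rewrite cNa addn0.
  - by nlia.
  - by rewrite addnn -muln2 exprM sqrr_sign /slope cNa; lra.
have [n0|n0] := posnP n; first by move: c0; rewrite const0 //; lra.
apply: (allcrit 1); [by left|done|move=> j jn].
by rewrite /slope -PP ?ifF //; nlia.
Qed.

Lemma alternant_exists : exists P, alternant n a t P.
Proof.
have [tN te] := talt.
have /mem_nodes[P Pn aP] := alternation_mem_kink.
have a11 : a \in `[-1, 1] by rewrite in_itv /= !ltW.
(* With the value [E] at [a] the left derivative would be nonnegative and the right one nonpositive,
   while the kink makes the right one larger by 2. *)
have eaE : e a = - E.
  have [//|ea] : e a = - E \/ e a = E.
    have [_] : S a by rewrite aP; exact: alternation_extremal.
    by case: (ger0P (e a)) => _ ea; [right|left]; move: ea; lra.
  have hL : 0 <= eL^`().[a].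
    apply: (deriv_ge0_left a1) => z; rewrite in_itv /= => /andP[z1 za].
    rewrite !eLE // ea; have /eE : z \in `[-1, 1] by rewrite in_itv /= z1 (le_trans za) // ltW.
    by rewrite ler_norml => /andP[].
  have hR : eR^`().[a] <= 0.
    apply: (deriv_le0_right a2) => z; rewrite in_itv /= => /andP[az z1].
    rewrite !eRE // ea; have /eE : z \in `[-1, 1] by rewrite in_itv /= z1 (le_trans _ az) // ltW.
    by rewrite ler_norml => /andP[].
  by move: hL hR; rewrite deL deR; lra.
have kP : odd k = odd P.+1.
  have := te P Pn; rewrite -aP eaE -signr_odd oddD /=.
  by case: (odd P); case: (odd k); rewrite ?expr0 ?expr1 //=; move: E0; lra.
exists P; split=> //.
  split=> // j jn; apply: (etrans (te j jn)); rewrite -signr_odd -[in RHS]signr_odd !oddD kP //.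
by move=> x x11 exE; apply/mem_nodes/extremal_mem_nodes.
Qed.

End Structure.
End ExtremalPoints.

(** * Points with too many alternation points are tips *)

Section VShapes.
Variable R : realType.
Implicit Types (n i j k : nat) (a b c x y z s : R) (p q : {poly R}) (t u : nat -> R).

(** A lower bound of de la Vallee Poussin type: if [q] did better for [a], its pullback [r] would
    differ from the best approximation for [c] by strictly alternating values at [n + 2] nodes, too
    many for degree [n]. *)
Lemma minimax_error_scale_ge n a c s t k : 0 < s ->
  alternates (err c (minimax_poly n c)) (minimax_error n c) n.+1 k t ->
  (forall j, (j <= n.+1)%N -> t j \in `[-1, 1]) ->
  (forall j, (j <= n.+1)%N -> a + s * (t j - c) \in `[-1, 1]) ->
  s * minimax_error n c <= minimax_error n a.
Proof.
move=> s0 [tN te] t11 ts; apply: minimax_error_ge => q sq.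
rewrite leNgt; apply/negP => qs.
set p := minimax_poly n c in te; set E := minimax_error n c in te qs.
pose r := s^-1 *: (q \Po (s%:P * 'X + (a - s * c)%:P)).
have sr : (size r <= n.+1)%N.
  rewrite (leq_trans (size_scale_leq _ _)) //.
  apply: (leq_trans (size_comp_poly_leq _ _)).
  have : (size (s%:P * 'X + (a - s * c)%:P)%R <= 2)%N.
    rewrite size_MXaddC; case: ifP => // _.
    by rewrite ltnS size_polyC leq_b1.
  move: sq; case: (size q) => [|m]; case: (size _) => [|[|[|l]]] //=; nia.
have rE x : err a q (a + s * (x - c)) = s * err c r x.
  rewrite /err /absf hornerZ horner_comp hornerMXaddC hornerC [RHS]mulrBr.
  congr (_ - _).
    have -> : a + s * (x - c) - a = s * (x - c) by ring.
    by rewrite normrM gtr0_norm.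
  rewrite mulrA divff ?gt_eqF // mul1r; congr _.[_]; ring.
have rlt j : (j <= n.+1)%N -> `|err c r (t j)| < E.
  move=> jn; rewrite -(ltr_pM2l s0) -{1}(gtr0_norm s0) -normrM -rE.
  by apply: le_lt_trans qs; apply: le_unorm; [exact: err_continuous|exact: ts].
pose g j := (r - p).[t j].
have gpos j : (j <= n.+1)%N -> 0 < (-1) ^+ (j + k) * g j.
  move=> jn; have -> : g j = err c p (t j) - err c r (t j).
    by rewrite /g /err hornerD hornerN; ring.
  rewrite te //; have := rlt j jn; rewrite ltr_norml.
  by rewrite -signr_odd; case: odd; rewrite ?expr0 ?expr1 => /andP[? ?]; slra.
have d0 : dd t g n.+1 0 = 0.
  apply: (dd_poly tN) => //.
  by rewrite (leq_trans (size_polyD _ _)) // geq_max sr size_polyN size_minimax_poly.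
have := @dd_alt_bound _ n.+1 t tN g n.+1 0 k 0 t11 (leqnn _).
rewrite d0 normr0 mulr0 normr_le0 => h.
have := gpos 0%N (leq0n _); rewrite (eqP (h _ _)) //; first by rewrite mulr0 ltxx.
by move=> j jn; apply/ltW/gpos.
Qed.

(** Dropping the last of the [n + 3] points leaves [n + 2] with room to their right. Rescaling about
    -1 by [(1 + a) / (1 + c)] keeps them in [-1, 1], so the upper and lower scaling bounds meet. *)
Lemma flank_right n c u k : -1 < c -> c < 1 -> 
  alternates (err c (minimax_poly n c)) (minimax_error n c) n.+2 k u ->
  (forall j, (j <= n.+2)%N -> u j \in `[-1, 1]) ->
  exists b, [/\ c < b, b < 1 & forall a, a \in `[c, b] ->
    minimax_error n a = minimax_error n c / (1 + c) * a + minimax_error n c / (1 + c)].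
Proof.
move=> c1 c2 [uN ue] u11.
have u0 : 0 < 1 + u n.+1.
  have := increasing_lt (i := 0) (j := n.+1) uN ltac:(nlia).
  have := u11 0%N (leq0n _); rewrite in_itv /=; slra.
have u1 : 1 + u n.+1 < 2.
  have := uN n.+1 (leqnn _).
  have := u11 n.+2 (leqnn _); rewrite in_itv /=; slra.
have [b [cb b1 bu]] : exists b, [/\ c < b, b < 1 & (1 + b) / (1 + c) * (1 + u n.+1) <= 2].
  (* The midpoint of [c] and 1 keeps [b] below 1; at the other value the last remaining point
     reaches 1. *)
  exists (Num.min ((1 + c) / 2) (2 * (1 + c) / (1 + u n.+1) - 1)); split.
  - rewrite lt_min; apply/andP; split; first slra.
    by rewrite ltrBrDr ltr_pdivlMr //; nra.
  - by rewrite gt_min; apply/orP; left; slra.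
  - set b := Num.min _ _.
    have : b <= 2 * (1 + c) / (1 + u n.+1) - 1 by rewrite ge_min lexx orbT.
    rewrite lerBrDr ler_pdivlMr // => h.
    by rewrite mulrAC ler_pdivrMr; [slra|slra].
exists b; split=> // a; rewrite in_itv /= => /andP[ca ab].
have a1 : a < 1 by slra.
have s0 : 0 < (1 + a) / (1 + c) by rewrite divr_gt0; slra.
have -> : minimax_error n c / (1 + c) * a + minimax_error n c / (1 + c) =
  (1 + a) / (1 + c) * minimax_error n c by ring.
apply/le_anti/andP; split.
  rewrite mulrAC ler_pdivlMr; last slra.
  by rewrite [leRHS]mulrC; apply: minimax_error_ratioL.
apply: (minimax_error_scale_ge s0 (t := u) (k := k)).
- by split=> [j jn|j jn]; [apply: uN|apply: ue]; nlia.
- by move=> j jn; apply: u11; nlia.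
move=> j jn.
have -> : a + (1 + a) / (1 + c) * (u j - c) = -1 + (1 + a) / (1 + c) * (1 + u j).
  by field; slra.
have uj0 : 0 <= 1 + u j by have := u11 j ltac:(nlia); rewrite in_itv /=; slra.
have uj1 : u j <= u n.+1 by apply: (increasing_le uN); nlia.
have : (1 + a) / (1 + c) * (1 + u j) <= (1 + b) / (1 + c) * (1 + u n.+1).
  by rewrite ler_pM ?ler_pM2r ?invr_gt0 ?(ltW s0) //; slra.
have : 0 <= (1 + a) / (1 + c) * (1 + u j) by rewrite mulr_ge0 // ltW.
by rewrite in_itv /=; slra.
Qed.

(** Mirror image of [flank_right]: the first point is dropped and the rescaling is about 1. *)
Lemma flank_left n c u k : -1 < c -> c < 1 -> 
  alternates (err c (minimax_poly n c)) (minimax_error n c) n.+2 k u ->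
  (forall j, (j <= n.+2)%N -> u j \in `[-1, 1]) ->
  exists b, [/\ -1 < b, b < c & forall a, a \in `[b, c] ->
    minimax_error n a = - (minimax_error n c / (1 - c)) * a + minimax_error n c / (1 - c)].
Proof.
move=> c1 c2 [uN ue] u11.
have u0 : 0 < 1 - u 1%N.
  have := increasing_lt (i := 1) (j := n.+2) uN ltac:(nlia).
  have := u11 n.+2 (leqnn _); rewrite in_itv /=; slra.
have u1 : 1 - u 1%N < 2.
  have := uN 0%N (ltn0Sn _).
  have := u11 0%N (leq0n _); rewrite in_itv /=; slra.
have [b [b1 bc bu]] : exists b, [/\ -1 < b, b < c & (1 - b) / (1 - c) * (1 - u 1%N) <= 2].
  exists (Num.max ((c - 1) / 2) (1 - 2 * (1 - c) / (1 - u 1%N))); split.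
  - by rewrite lt_max; apply/orP; left; slra.
  - rewrite gt_max; apply/andP; split; first slra.
    by rewrite ltrBlDr -ltrBlDl ltr_pdivlMr //; nra.
  - set b := Num.max _ _.
    have : 1 - 2 * (1 - c) / (1 - u 1%N) <= b by rewrite le_max lexx orbT.
    rewrite lerBlDr -lerBlDl ler_pdivlMr // => h.
    by rewrite mulrAC ler_pdivrMr; [slra|slra].
exists b; split=> // a; rewrite in_itv /= => /andP[ba ac].
have a1 : -1 < a by slra.
have s0 : 0 < (1 - a) / (1 - c) by rewrite divr_gt0; slra.
have -> : - (minimax_error n c / (1 - c)) * a + minimax_error n c / (1 - c) =
  (1 - a) / (1 - c) * minimax_error n c by ring.
apply/le_anti/andP; split.
  rewrite mulrAC ler_pdivlMr; last slra.
  by rewrite [leRHS]mulrC; apply: minimax_error_ratioR.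
apply: (minimax_error_scale_ge s0 (t := fun j => u j.+1) (k := k.+1)).
- split=> j jn; first by apply: uN; nlia.
  by rewrite ue; [rewrite addSnnS|nlia].
- by move=> j jn; apply: u11; nlia.
move=> j jn.
have -> : a + (1 - a) / (1 - c) * (u j.+1 - c) = 1 - (1 - a) / (1 - c) * (1 - u j.+1).
  by field; slra.
have uj0 : 0 <= 1 - u j.+1 by have := u11 j.+1 ltac:(nlia); rewrite in_itv /=; slra.
have uj1 : u 1%N <= u j.+1 by apply: (increasing_le uN); nlia.
have : (1 - a) / (1 - c) * (1 - u j.+1) <= (1 - b) / (1 - c) * (1 - u 1%N).
  by rewrite ler_pM ?ler_pM2r ?invr_gt0 ?(ltW s0) //; slra.
have : 0 <= (1 - a) / (1 - c) * (1 - u j.+1) by rewrite mulr_ge0 // ltW.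
by rewrite in_itv /=; slra.
Qed.

(** By continuity the infimum of the admissible left ends is admissible. Applied to the minimax
    error minus an affine function, this finds the end of a V-shape. *)
Lemma maximal_zero_left (g : R -> R) d a c : continuous g -> d <= a -> a <= c ->
  (forall x, x \in `[a, c] -> g x = 0) ->
  exists a0, [/\ d <= a0, a0 <= a, forall x, x \in `[a0, c] -> g x = 0 &
    forall a', d <= a' -> a' <= a0 ->
      (forall x, x \in `[a', c] -> g x = 0) -> a' = a0].
Proof.
move=> gc da ac g0.
pose A := [set a' | [/\ d <= a', a' <= a & forall x, x \in `[a', c] -> g x = 0]].
have hA : has_inf A by split; [exists a; split|exists d => x []].
have dinf : d <= inf A by apply: lb_le_inf => [|x []//]; exists a; split.
have infa : inf A <= a by apply: ge_inf; [exists d => x []|split].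
have g0' x : inf A < x -> x <= c -> g x = 0.
  move=> Ax xc; have [y [dy ya gy] yx] : exists2 y, A y & y < inf A + (x - inf A).
    by apply: inf_adherent => //; rewrite subr_gt0.
  by apply: gy; rewrite in_itv /= xc andbT ltW //; move: yx; rewrite addrC subrK.
have ginf : g (inf A) = 0.
  apply/eqP/negPn/negP => gn; have gn0 : 0 < `|g (inf A)| by rewrite normr_gt0.
  have /cvgrPdist_lt/(_ _ gn0) [e /= e0 he] := gc (inf A).
  have [y [dy ya gy] yx] : exists2 y, A y & y < inf A + e by apply: inf_adherent.
  have Ay : inf A <= y by apply: ge_inf; [exists d => z []|split].
  have gy0 : g y = 0 by apply: gy; rewrite in_itv /= lexx (le_trans ya).
  have /he : ball (inf A) e y by rewrite /ball /= ler0_norm; slra.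
  by rewrite /= gy0 subr0 ltxx.
exists (inf A); split=> //.
  move=> x; rewrite in_itv /= le_eqVlt => /andP[/predU1P[<-//|Ax] xc].
  exact: g0'.
move=> a' da' a'A ga'; apply/le_anti; rewrite a'A /=.
by apply: ge_inf; [exists d => x []|split=> //; exact: le_trans infa].
Qed.

Lemma maximal_zero_right (g : R -> R) d b c : continuous g -> b <= d -> c <= b ->
  (forall x, x \in `[c, b] -> g x = 0) ->
  exists b0, [/\ b0 <= d, b <= b0, forall x, x \in `[c, b0] -> g x = 0 &
    forall b', b' <= d -> b0 <= b' ->
      (forall x, x \in `[c, b'] -> g x = 0) -> b' = b0].
Proof.
move=> gc bd cb g0.
have gc' : continuous (g \o -%R).
  by move=> x; apply: continuous_comp; [exact: oppr_continuous|exact: gc].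
have g0' x : x \in `[- b, - c] -> (g \o -%R) x = 0.
  by rewrite in_itv /= => /andP[? ?]; apply: g0; rewrite in_itv /=; slra.
have db : - d <= - b by rewrite lerN2.
have bc : - b <= - c by rewrite lerN2.
have [b0 [db0 b0b gb0 bmax]] := maximal_zero_left gc' db bc g0'.
exists (- b0); split; [slra|slra| |].
  by move=> x; rewrite in_itv /= => /andP[? ?]; rewrite -[x]opprK; apply: gb0; rewrite in_itv /=; slra.
move=> b' b'd b0b' gb'; apply: oppr_inj; rewrite opprK; apply: bmax; [slra|slra|].
by move=> x; rewrite in_itv /= => /andP[? ?]; apply: gb'; rewrite in_itv /=; slra.
Qed.

Lemma affine_coef_eq (m1 t1 m2 t2 x y : R) : x != y ->
  m1 * x + t1 = m2 * x + t2 -> m1 * y + t1 = m2 * y + t2 -> m1 = m2 /\ t1 = t2.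
Proof.
move=> xy hx hy; have m12 : (m1 - m2) * (x - y) = 0 by slra.
move/eqP: m12; rewrite mulf_eq0 !subr_eq0 (negbTE xy) orbF => /eqP m12.
by split=> //; move: hx; rewrite m12; slra.
Qed.

(** Between two different tips the error would be both strictly decreasing and strictly
    increasing. *)
Lemma has_vshape_tip_eq n a b c a' b' c' : has_vshape n a b c ->
  has_vshape n a' b' c' -> a' <= a -> b <= b' -> c' = c.
Proof.
move=> [_ + _ [_ dec] [_ inc]] [_ + _ [_ dec'] [_ inc']] a'a bb'.
rewrite !in_itv /= => /andP[ac cb] /andP[a'c' c'b'].
have [cc'|cc'|//] := ltgtP c' c.
- pose y := Num.max a c'.
  have [yc ay c'y] : [/\ y < c, a <= y & c' <= y].
    by rewrite /y gt_max ac cc' !le_max !lexx orbT.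
  have h1 : minimax_error n c < minimax_error n y.
    by apply: dec => //; rewrite in_itv /=; slra.
  have : minimax_error n y < minimax_error n c.
    by apply: inc' => //; rewrite in_itv /=; slra.
  slra.
- pose y := Num.min b c'.
  have [yc ay c'y] : [/\ c < y, y <= b & y <= c'].
    by rewrite /y lt_min cb cc' !ge_min !lexx orbT.
  have h1 : minimax_error n c < minimax_error n y.
    by apply: inc => //; rewrite in_itv /=; slra.
  have : minimax_error n y < minimax_error n c.
    by apply: dec' => //; rewrite in_itv /=; slra.
  slra.
Qed.

(** The two flanks are extended as far as their affine formulas persist. A larger V has the same tip
    by [has_vshape_tip_eq], and its affine pieces agree with these at two points each, so it is not
    larger after all. *)
Lemma vshape_tip_of_many n c u k : -1 < c -> c < 1 ->
  alternates (err c (minimax_poly n c)) (minimax_error n c) n.+2 k u ->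
  (forall j, (j <= n.+2)%N -> u j \in `[-1, 1]) -> vshape_tip n c.
Proof.
move=> c1 c2 ualt u11.
have E0 := minimax_error_gt0 n c1 c2.
have [a1 [a11 a1c ha]] := flank_left c1 c2 ualt u11.
have [b1 [cb1 b11 hb]] := flank_right c1 c2 ualt u11.
set m1 := - (_ / (1 - c)) in ha; set t1 := _ / (1 - c) in ha.
set m2 := _ / (1 + c) in hb.
have m1neg : m1 < 0 by rewrite oppr_lt0 divr_gt0 //; slra.
have m2pos : 0 < m2 by rewrite divr_gt0 //; slra.
have lc m s : continuous (fun x => minimax_error n x - (m * x + s)).
  move=> x; apply: cvgB; first exact: minimax_error_continuous.
  apply: cvgD; last exact: cvg_cst.
  by apply: cvgM; [exact: cvg_cst|exact: cvg_id].
have [|a [a0 aa1 ga amax]] := maximal_zero_left (lc m1 t1) (ltW a11) (ltW a1c).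
  by move=> x xa; rewrite ha // subrr.
have [|b [b0 bb1 gb bmax]] := maximal_zero_right (lc m2 m2) (ltW b11) (ltW cb1).
  by move=> x xa; rewrite hb // subrr.
have Ea x : x \in `[a, c] -> minimax_error n x = m1 * x + t1.
  by move=> xa; apply/eqP; rewrite -subr_eq0 ga.
have Eb x : x \in `[c, b] -> minimax_error n x = m2 * x + m2.
  by move=> xa; apply/eqP; rewrite -subr_eq0 gb.
have ac : a < c by slra.
have cb : c < b by slra.
have V : has_vshape n a b c.
  split=> //; first by rewrite in_itv /= ac cb.
  - by apply: continuous_subspaceT; exact: minimax_error_continuous.
  - split; first by exists m1, t1.
    move=> x y xa ya xy; rewrite !Ea // ltrD2r.
    by rewrite ltr_nM2l.
  - split; first by exists m2, m2.
    move=> x y xa ya xy; rewrite !Eb // ltrD2r.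
    by rewrite ltr_pM2l.
exists a, b; split=> // a' b' c' V' a'a bb'.
have cE := has_vshape_tip_eq V V' a'a bb'; rewrite {}cE {c'} in V'.
case: V' => [[a'1 b'1] _ _ [[m [s ms]] _] [[m' [s' ms']] _]].
split.
  apply: amax => // x xa'.
  have [|||mE sE] := @affine_coef_eq m s m1 t1 a c; rewrite ?lt_eqF //.
  - by rewrite -ms ?Ea ?in_itv /= ?lexx ?a'a ?ltW.
  - by rewrite -ms ?Ea ?in_itv /= ?lexx ?ltW ?(le_lt_trans a'a).
  - by rewrite ms // mE sE subrr.
apply: bmax => // x xb'.
have [|||mE sE] := @affine_coef_eq m' s' m2 m2 c b; rewrite ?lt_eqF //.
- by rewrite -ms' ?Eb ?in_itv /= ?lexx ?ltW ?(lt_le_trans cb).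
- by rewrite -ms' ?Eb ?in_itv /= ?lexx ?bb' ?ltW.
- by rewrite ms' // mE sE subrr.
Qed.

End VShapes.

(** * Local constancy *)

Section LocalConstancy.
Variable R : realType.
Implicit Types (n i j k P : nat) (a b c d x y z : R) (p q : {poly R}) (t u : nat -> R).

Lemma err_lipschitz c p : exists2 K, 0 < K &
  forall x y, x \in `[-1, 1] -> y \in `[-1, 1] ->
    `|err c p x - err c p y| <= K * `|x - y|.
Proof.
have [k k1 kP] := poly_lipshitz p (-1) 1.
exists (1 + k) => [|x y x11 y11]; first slra.
have -> : err c p x - err c p y = (`|x - c| - `|y - c|) - (p.[x] - p.[y]).
  by rewrite /err /absf; ring.
rewrite (le_trans (ler_normB _ _)) // mulrDl mul1r lerD ?kP //.
rewrite (le_trans (ler_dist_dist _ _)) //.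
by rewrite (_ : x - c - (y - c) = x - y) //; ring.
Qed.

(** [node_bound] asks for nodes that are injective on all of [nat]. *)
Lemma increasing_extension m t : increasing_upto m t ->
  exists2 u, injective u & forall j, (j <= m)%N -> u j = t j.
Proof.
move=> tm; pose u j := if (j <= m)%N then t j else t m + (j - m)%:R.
exists u; last by move=> j jm; rewrite /u jm.
have uS j : u j < u j.+1.
  rewrite /u; case: (ltngtP j m) => jm; first exact: tm.
    by rewrite ltrD2l ltr_nat; nlia.
  by rewrite jm ltrDl ltr0n; nlia.
move=> i j uij; apply: (@increasing_inj _ (maxn i j) u) => //.
- by rewrite leq_maxl.
- by rewrite leq_maxr.
Qed.

(* Strong unicity: at the alternation points of [c] the difference is bounded
   from one side, on alternating sides, and its divided difference is zero. *)
Lemma minimax_poly_lipschitz n c t k :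
  alternates (err c (minimax_poly n c)) (minimax_error n c) n.+1 k t ->
  (forall j, (j <= n.+1)%N -> t j \in `[-1, 1]) ->
  exists2 C, 0 <= C & forall a y, y \in `[-1, 1] ->
    `|(minimax_poly n a - minimax_poly n c).[y]| <= C * `|a - c|.
Proof.
move=> [tN te] t11.
have tn : increasing_upto n t by move=> j jn; apply: tN; nlia.
have [u uinj ut] := increasing_extension tn.
have [C [C0 Cb]] := node_bound n uinj.
pose W : R := dd t (fun j => (-1) ^+ (j + k)) n.+1 0.
(* The divided difference of [h] below is [2 * d * W]; the summand 1 pays for passing from [h] back
   to [q]. *)
pose M : R := 2 * (2 ^+ n.+1 * `|W| + 1).
have M0 : 0 <= M by rewrite mulr_ge0 // addr_ge0 // mulr_ge0 // exprn_ge0.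
exists (C * M); first exact: mulr_ge0.
move=> a y y11; set d := `|a - c|; have d0 : 0 <= d by exact: normr_ge0.
set q := minimax_poly n a - minimax_poly n c.
have sq : (size q <= n.+1)%N.
  by rewrite (leq_trans (size_polyD _ _)) // geq_max size_polyN !size_minimax_poly.
rewrite -mulrA; apply: (Cb q (M * d) sq _ y y11) => i ni; rewrite ut //.
(* The minimax error and the approximated function each move by at most [d], so a shift by [2 * d]
   gives [q] weakly alternating signs. *)
pose h j := q.[t j] + 2 * d * (-1) ^+ (j + k).
have hpos j : (0 <= j <= 0 + n.+1)%N -> 0 <= (-1) ^+ (j + k) * h j.
  move=> /andP[_ jn]; rewrite /h.
  have h1 := err_minimax_le n a (t11 j jn).
  have h2 := te j jn.
  have h3 := minimax_error_lipschitz n a c.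
  have h4 := absfB a c (t j).
  have qE : q.[t j] = err c (minimax_poly n c) (t j) -
      err a (minimax_poly n a) (t j) + (`|t j - a| - `|t j - c|).
    by rewrite /q /err /absf hornerD hornerN; ring.
  move: h1 h2 h3 h4 qE; rewrite -/d !ler_norml -signr_odd.
  by case: odd; rewrite ?expr0 ?expr1 => /andP[? ?] ? /andP[? ?] /andP[? ?] ?; slra.
have dW : dd t h n.+1 0 = 2 * d * W.
  by rewrite ddD (dd_poly tN) // add0r ddZ.
have hi : `|h i| <= 2 ^+ n.+1 * `|2 * d * W|.
  by rewrite -dW; apply: (dd_alt_bound tN t11 _ hpos); nlia.
have -> : q.[t i] = h i - 2 * d * (-1) ^+ (i + k) by rewrite /h addrK.
rewrite (le_trans (ler_normB _ _)) // /M.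
have -> : 2 * (2 ^+ n.+1 * `|W| + 1) * d = 2 ^+ n.+1 * `|2 * d * W| + 2 * d.
  by rewrite !normrM (ger0_norm d0) (ger0_norm (ler0n _ 2)); ring.
apply: lerD => //.
by rewrite !normrM normrX normrN1 expr1n mulr1 (ger0_norm d0) ger0_norm.
Qed.

(** For [a] near [c] every node of [a] is close to a node of [c], and consecutive nodes are close to
    distinct ones in the same order. A strictly increasing map of the [n + 2] ranks into themselves
    is the identity, and it sends [P'] to [P] because [a] is near [c]. *)
Lemma alternant_locally_constant n c t P : -1 < c -> c < 1 ->
  alternant n c t P -> exists2 d, 0 < d &
    forall a t' P', `|a - c| < d -> alternant n a t' P' -> P' = P.
Proof.
move=> c1 c2 [tA Pn tP t11 tS]; have E0 := minimax_error_gt0 n c1 c2.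
have [C C0 hC] := minimax_poly_lipschitz tA t11.
set e := err c _ in tA tS; set E := minimax_error n c in tA tS E0.
have [tN te] := tA.
have [K K0 hK] := err_lipschitz c (minimax_poly n c); rewrite -/e in hK.
(* Within distance [r] of a node the error for [c] stays within [E / 2] of its value there, hence
   keeps its sign. *)
pose r := E / (2 * K).
have r0 : 0 < r by rewrite divr_gt0 // mulr_gt0.
have Kr : K * r = E / 2 by rewrite /r; field; rewrite gt_eqF.
pose far := [set x | forall j, (j <= n.+1)%N -> r <= `|x - t j|].
have [rho rho0 hrho] : exists2 rho, 0 < rho &
    forall x, x \in `[-1, 1] -> far x -> `|e x| <= E - rho.
  apply: closed_gap; first exact: err_continuous.
    have -> : far = \bigcap_(j in [set j | (j <= n.+1)%N]) [set x | r <= `|x - t j|] by [].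
    apply: closed_bigI => j _.
    have jc : continuous (fun x : R => `|x - t j|).
      by move=> x; apply: cvg_norm; apply: cvgB; [exact: cvg_id|exact: cvg_cst].
    by move/continuous_closedP: jc => /(_ _ (@closed_ge R r)).
  move=> x x11 xfar; rewrite lt_neqAle err_minimax_le // andbT; apply/eqP => exE.
  have [j jn xj] := tS x x11 exE.
  by have := xfar j jn; rewrite xj subrr normr0 leNgt r0.
pose m := Num.min r (Num.min rho (E / 2)).
have m0 : 0 < m by rewrite !lt_min r0 rho0 divr_gt0.
(* Per unit of [|a - c|], the error function changes by at most [C + 1] and the minimax error by at
   most 1. *)
exists (m / (C + 2)); first by rewrite divr_gt0 //; slra.
move=> a t' P' ac [[t'N t'e] P'n t'P t'11 _].
set d := `|a - c| in ac; have d0 : 0 <= d by exact: normr_ge0.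
have dm : d * (C + 2) < m by rewrite -ltr_pdivlMr //; slra.
move: dm; rewrite !lt_min => /and3P[dr drho dE].
have {}dr : d < r by nra.
set ea := err a _ in t'e; set Ea := minimax_error n a in t'e.
have eea x : x \in `[-1, 1] -> `|ea x - e x| <= (C + 1) * d.
  move=> x11; rewrite errB (le_trans (ler_normB _ _)) // mulrDl mul1r addrC lerD //.
    exact: hC.
  exact: absfB.
have EaE : E - d <= Ea.
  by have := minimax_error_lipschitz n a c; rewrite ler_norml => /andP[+ _]; rewrite -/E -/Ea -/d; slra.
have near_ex i : (i <= n.+1)%N -> exists2 j, (j <= n.+1)%N & `|t' i - t j| < r.
  move=> iN; have ti := t'11 i iN.
  apply: contrapT => nex.
  have : `|e (t' i)| <= E - rho.
    apply: hrho => // j jn; rewrite leNgt; apply/negP => h; apply: nex; by exists j.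
  have Ea0 : 0 <= Ea by exact: minimax_error_ge0.
  have : `|ea (t' i)| = Ea by rewrite t'e // normrM normrX normrN1 expr1n mul1r ger0_norm.
  have := ler_normD (ea (t' i) - e (t' i)) (e (t' i)); rewrite subrK.
  by have := eea _ ti; nra.
have tgap i j : (i < j <= n.+1)%N -> 2 * r < t j - t i.
  move=> ij; have tii : t i <= t i.+1 by apply: (increasing_le tN); nlia.
  have tij : t i.+1 <= t j by apply: (increasing_le tN); nlia.
  have := hK _ _ (t11 i.+1 ltac:(nlia)) (t11 i ltac:(nlia)).
  have -> : `|e (t i.+1) - e (t i)| = 2 * E.
    rewrite !te; [|nlia|nlia]; rewrite addSn exprS mulN1r mulNr -opprD normrN.
    by rewrite -mulr2n normrMn normrM normrX normrN1 expr1n mul1r gtr0_norm // mulr_natl.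
  have -> : `|t i.+1 - t i| = t i.+1 - t i.
    by rewrite gtr0_norm // subr_gt0; apply: tN; nlia.
  move=> h; rewrite -(ltr_pM2l K0) mulrBr.
  have : K * t i.+1 <= K * t j by rewrite ler_pM2l.
  by move: h; rewrite mulrBr mulrCA Kr; slra.
have near_lt i j j' : (i < n.+1)%N -> (j <= n.+1)%N -> (j' <= n.+1)%N ->
    `|t' i - t j| < r -> `|t' i.+1 - t j'| < r -> (j < j')%N.
  move=> iN jn j'n ij ij'.
  have ii : t' i < t' i.+1 by exact: t'N.
  case: (ltngtP j j') => // jj'.
    have := tgap j' j ltac:(nlia); move: ij ij'; rewrite !ltr_norml.
    by move=> /andP[? ?] /andP[? ?]; slra.
  rewrite -{}jj' in ij'.
  have ti := t'11 i ltac:(nlia); have ti1 := t'11 i.+1 iN.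
  have h1 := hK _ _ ti (t11 j jn); have h2 := hK _ _ ti1 (t11 j jn).
  have h1' : `|e (t' i) - e (t j)| < E / 2.
    by apply: le_lt_trans h1 _; rewrite -Kr ltr_pM2l.
  have h2' : `|e (t' i.+1) - e (t j)| < E / 2.
    by apply: le_lt_trans h2 _; rewrite -Kr ltr_pM2l.
  have h3 := eea _ ti; have h4 := eea _ ti1.
  have eopp : ea (t' i.+1) = - ea (t' i).
    by rewrite !t'e; [rewrite addSn exprS mulN1r mulNr|nlia|].
  have etj : e (t j) = E \/ e (t j) = - E.
    by rewrite te // -signr_odd; case: odd; rewrite ?expr0 ?expr1; [right|left]; slra.
  have Cd : (C + 1) * d < E / 2 by nra.
  move: h1' h2' h3 h4; rewrite !ltr_norml !ler_norml eopp.
  by move=> /andP[? ?] /andP[? ?] /andP[? ?] /andP[? ?]; case: etj; slra.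
have near_ge i : forall j, (i <= n.+1)%N -> (j <= n.+1)%N -> `|t' i - t j| < r -> (i <= j)%N.
  elim: i => // i IH j iN jn ij.
  have [j' j'n ij'] := near_ex i (ltnW iN).
  exact: leq_ltn_trans (IH j' (ltnW iN) j'n ij') (near_lt _ _ _ iN j'n jn ij' ij).
have near_le i : forall j, (i <= n.+1)%N -> (j <= n.+1)%N ->
    `|t' (n.+1 - i)%N - t j| < r -> (j <= n.+1 - i)%N.
  elim: i => [|i IH] j iN jn ij; first by rewrite subn0.
  have [j' j'n ij'] := near_ex (n.+1 - i)%N (leq_subr _ _).
  have iE : (n.+1 - i = (n.+1 - i.+1).+1)%N by nlia.
  have h1 := IH j' (ltnW iN) j'n ij'.
  rewrite iE in ij' h1.
  have := near_lt (n.+1 - i.+1)%N j j' ltac:(nlia) jn j'n ij ij'.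
  by move=> h2; nlia.
have tPP : `|t' P' - t P| < r by rewrite t'P tP.
apply/eqP; rewrite eqn_leq (near_ge P' P P'n Pn tPP) /=.
have := near_le (n.+1 - P')%N P ltac:(nlia) Pn; rewrite subKn //.
exact.
Qed.

Definition kink_index n a P := exists t, alternant n a t P.

(** Connectedness: the supremum of the points up to which the rank is [P] has rank [P] itself by
    local constancy, and lies at [b] because otherwise it could be passed. *)
Lemma kink_index_const n (I : set R) : is_interval I -> I `<=` `]-1, 1[ ->
  (forall a, I a -> exists P, kink_index n a P) ->
  forall a b P Q, I a -> I b -> a <= b -> kink_index n a P ->
    kink_index n b Q -> P = Q.
Proof.
move=> Iitv I1 Iex a b P Q Ia Ib ab aP bQ.
have I11 c : I c -> -1 < c /\ c < 1.
  by move=> /I1 /=; rewrite in_itv /= => /andP[].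
have loc c : I c -> exists Pc d, [/\ kink_index n c Pc, 0 < d &
    forall x P', `|x - c| < d -> kink_index n x P' -> P' = Pc].
  move=> Ic; have [Pc [t ct]] := Iex c Ic; have [c1 c2] := I11 c Ic.
  have [d d0 dP] := alternant_locally_constant c1 c2 ct.
  exists Pc, d; split=> //; first by exists t.
  by move=> x P' xd [t' xt']; exact: dP xd xt'.
have uniq_index c P1 P2 : I c -> kink_index n c P1 -> kink_index n c P2 -> P1 = P2.
  move=> Ic c1 c2; have [Pc [d [_ d0 dP]]] := loc c Ic.
  have cd : `|c - c| < d by rewrite subrr normr0.
  by rewrite (dP c P1 cd c1) (dP c P2 cd c2).
have Iab x : a <= x -> x <= b -> I x by move=> ax xb; apply: (Iitv a b) => //; rewrite ax xb.
pose A := [set x | a <= x <= b /\ forall y, a <= y <= x -> kink_index n y P].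
have Aa : A a.
  split=> [|y]; first by rewrite lexx ab.
  by rewrite andbC => /le_anti ->.
have hA : has_sup A by split; [exists a|exists b => x [/andP[]]].
pose s := sup A.
have as_ : a <= s by apply: ub_le_sup => //; case: hA.
have sb : s <= b by apply: ge_sup; [exists a|move=> x [/andP[]]].
have Is := Iab s as_ sb.
have [Ps [d [sPs d0 dP]]] := loc s Is.
have below y : a <= y -> y < s -> kink_index n y P.
  move=> ay ys; have [x [_ Ax] yx] : exists2 x, A x & s - (s - y) < x.
    by apply: sup_adherent => //; rewrite subr_gt0.
  by apply: Ax; rewrite ay ltW //; move: yx; rewrite subKr.
have PsP : Ps = P.
  have [x [/andP[ax xb] Ax] sx] : exists2 x, A x & s - d < x by apply: sup_adherent.
  have xs : x <= s by apply: ub_le_sup; [case: hA|split=> //; rewrite ax].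
  apply/esym/(dP x); first by rewrite distrC ger0_norm; slra.
  by apply: Ax; rewrite ax lexx.
rewrite PsP in sPs dP.
have upto z : s <= z -> z <= b -> z < s + d -> A z.
  move=> sz zb zd; split=> [|y /andP[ay yz]]; first by rewrite zb (le_trans as_).
  have [ys|sy] := ltP y s; first exact: below.
  have [P' yP'] := Iex y (Iab y ay (le_trans yz zb)).
  by rewrite -(dP y P' _ yP') // ger0_norm; slra.
move: sb; rewrite le_eqVlt => /predU1P[sbE|sb].
  by rewrite sbE in sPs; exact: uniq_index Ib sPs bQ.
have [z [sz zb zd]] : exists z, [/\ s < z, z <= b & z < s + d].
  exists (Num.min b (s + d / 2)); rewrite lt_min sb ge_min lexx gt_min.
  split=> //; first by slra.
  by apply/orP; right; slra.
have Az := upto z (ltW sz) zb zd.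
have zs : z <= s := ub_le_sup (proj2 hA) Az.
by exfalso; slra.
Qed.

End LocalConstancy.

(** * The alternation points *)

Section PointLists.
Variable R : realType.
Implicit Types (n i j P : nat) (a b x y : R) (t : nat -> R).

(** The distances to [a] are distinct on [s], so the sorted list does not depend on the enumeration
    of [B] that it starts from. *)
Lemma by_distance_eq a (B : set R) (s : seq R) : uniq s ->
  (forall x, B x <-> x \in s) ->
  {in s &, injective (fun x => `|x - a|)} ->
  sorted (fun x y => `|x - a| <= `|y - a|) s -> by_distance a B = s.
Proof.
move=> us Bs sinj ss; rewrite /by_distance.
set leT := fun x y : R => _ in ss *.
have tr : transitive leT by move=> y x z; exact: le_trans.
have BE : B = [set` s] by apply/seteqP; split=> x /Bs.
have Bfin : finite_set B by rewrite BE; exact: finite_seq.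
rewrite -[RHS](sorted_sort tr ss).
apply/perm_sort_inP.
- by move=> x y _ _; exact: le_total.
- by move=> x y z _ _ _; exact: tr.
- move=> x y; rewrite !in_fset_set // !inE => /Bs xs /Bs ys.
  by move=> /le_anti; exact: sinj.
- apply: uniq_perm => // [|x]; first exact: fset_uniq.
  rewrite in_fset_set //.
  by apply/idP/idP; rewrite inE => /Bs.
Qed.

Section Alternant.
Variables (n : nat) (a : R) (t : nat -> R) (P : nat).
Hypothesis atP : alternant n a t P.

Lemma alternation_setP x : alternation_set n a x <->
  exists2 j, (j <= n.+1)%N & x = t j.
Proof.
have [[tN te] Pn tP t11 tS] := atP.
split=> [[x11 xE]|[j jn ->]]; first exact: tS.
split; first exact: t11.
by rewrite te // normrM normrX normrN1 expr1n mul1r ger0_norm // minimax_error_ge0.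
Qed.

Lemma left_pointsE : left_points n a = mkseq (fun i => t (P.-1 - i)%N) P.
Proof.
have [[tN te] Pn tP t11 tS] := atP.
have idx x : x \in mkseq (fun i => t (P.-1 - i)%N) P -> exists2 j, (j < P)%N & x = t j.
  by move=> /mapP[i]; rewrite mem_iota => iP ->; exists (P.-1 - i)%N => //; nlia.
have tlt j : (j < P)%N -> t j < a.
  by move=> jP; rewrite -tP; apply: (increasing_lt tN); nlia.
apply: by_distance_eq.
- apply/(uniqP 0) => i j; rewrite !inE size_mkseq => iN jN.
  rewrite !nth_mkseq // => /(increasing_inj tN); move=> h.
  by have := h ltac:(nlia) ltac:(nlia); nlia.
- move=> x; split.
    move=> [/alternation_setP[j jn ->]]; rewrite /= -tP (increasing_ltE tN) // => jP.
    by apply/mapP; exists (P.-1 - j)%N; [rewrite mem_iota; nlia|congr t; nlia].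
  move=> /idx[j jP ->]; split; last exact: tlt.
  by apply/alternation_setP; exists j => //; nlia.
- move=> x y /idx[i iP ->] /idx[j jP ->].
  by have := tlt i iP; have := tlt j jP => ? ?; rewrite !ltr0_norm; slra.
- apply/(sortedP 0) => i; rewrite size_mkseq => iP.
  rewrite !nth_mkseq //; last exact: ltnW.
  have := tlt (P.-1 - i)%N ltac:(nlia); have := tlt (P.-1 - i.+1)%N ltac:(nlia).
  have : t (P.-1 - i.+1)%N <= t (P.-1 - i)%N by apply: (increasing_le tN); nlia.
  by move=> ? ? ?; rewrite !ltr0_norm; slra.
Qed.

Lemma right_pointsE :
  right_points n a = mkseq (fun i => t (P.+1 + i)%N) (n.+1 - P).
Proof.
have [[tN te] Pn tP t11 tS] := atP.
have idx x : x \in mkseq (fun i => t (P.+1 + i)%N) (n.+1 - P) ->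
    exists2 j, (P < j <= n.+1)%N & x = t j.
  by move=> /mapP[i]; rewrite mem_iota => iP ->; exists (P.+1 + i)%N => //; nlia.
have tlt j : (P < j <= n.+1)%N -> a < t j.
  by move=> jP; rewrite -tP; apply: (increasing_lt tN); nlia.
apply: by_distance_eq.
- apply/(uniqP 0) => i j; rewrite !inE size_mkseq => iN jN.
  rewrite !nth_mkseq // => /(increasing_inj tN); move=> h.
  by have := h ltac:(nlia) ltac:(nlia); nlia.
- move=> x; split.
    move=> [/alternation_setP[j jn ->]]; rewrite /= -tP (increasing_ltE tN) // => jP.
    by apply/mapP; exists (j - P.+1)%N; [rewrite mem_iota; nlia|congr t; nlia].
  move=> /idx[j jP ->]; split; last exact: tlt.
  by apply/alternation_setP; exists j => //; nlia.
- move=> x y /idx[i iP ->] /idx[j jP ->].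
  by have := tlt i iP; have := tlt j jP => ? ?; rewrite !gtr0_norm; slra.
- apply/(sortedP 0) => i; rewrite size_mkseq => iP.
  rewrite !nth_mkseq //; last exact: ltnW.
  have := tlt (P.+1 + i)%N ltac:(nlia); have := tlt (P.+1 + i.+1)%N ltac:(nlia).
  have : t (P.+1 + i)%N <= t (P.+1 + i.+1)%N by apply: (increasing_le tN); nlia.
  by move=> ? ? ?; rewrite !gtr0_norm; slra.
Qed.

Lemma upointE i : (i <= P)%N -> upoint n i a = t (P - i)%N.
Proof.
have [_ _ tP _ _] := atP; rewrite /upoint left_pointsE.
case: i => [|i] iP; first by rewrite subn0 tP.
by rewrite [LHS]/= nth_mkseq //; congr t; nlia.
Qed.

Lemma vpointE j : (P + j <= n.+1)%N -> vpoint n j a = t (P + j)%N.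
Proof.
have [_ _ tP _ _] := atP; rewrite /vpoint right_pointsE.
case: j => [|j] jP; first by rewrite addn0 tP.
by rewrite [LHS]/= nth_mkseq //; [rewrite addSnnS|nlia].
Qed.

End Alternant.
End PointLists.

(** * Constant rank and monotonicity on an interval without tips *)

Lemma kink_index_exists (R : realType) n (c : R) : -1 < c -> c < 1 ->
  ~ vshape_tip n c -> exists P, kink_index n c P.
Proof.
move=> c1 c2 notip.
have [sp pE] := minimax_polyP n c.
have [t [k [talt t0 tn]]] := chebyshev_alternation sp pE (minimax_error_gt0 n c1 c2).
have [tN _] := talt.
have t11 j : (j <= n.+1)%N -> t j \in `[-1, 1].
  move=> jn; rewrite in_itv /=; apply/andP; split.
    by apply: (le_trans t0); apply: (increasing_le tN).
  by apply: le_trans tn; apply: (increasing_le tN); rewrite jn leqnn.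
have [|P cP] := alternant_exists c1 c2 talt t11.
  by move=> u k' ualt u11; exact/notip/(vshape_tip_of_many c1 c2 ualt u11).
by exists P, t.
Qed.

(** The rank [P] of [alpha] among the nodes is constant on [I], which gives [k = P - 1] and
    [l = n - P]. Each point is then a node of fixed rank, to which [alternant_mono] applies. *)
Theorem theorem3 (R : realType) (n : nat) (I : set R) :
  is_interval I ->
  I `<=` `]-1, 1[ ->
  (forall c : R, vshape_tip n c -> ~ I c) ->
  exists k l : int,
    [/\ forall alpha, I alpha ->
          left_index n alpha = k /\ right_index n alpha = l,
        forall i : nat, i%:Z <= k ->
          {in I &, {homo upoint n i : alpha beta / alpha <= beta}} &
        forall j : nat, j%:Z <= l ->
          {in I &, {homo vpoint n j : alpha beta / alpha <= beta}}].
Proof.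
move=> Iitv I1 notip.
have I11 c : I c -> -1 < c /\ c < 1.
  by move=> /I1 /=; rewrite in_itv /= => /andP[].
have Iex c : I c -> exists P, kink_index n c P.
  move=> Ic; have [c1 c2] := I11 c Ic; apply: kink_index_exists => // tip.
  exact: notip tip Ic.
(* On an empty [I] any two indices do. *)
have [[c Ic]|Inone] := pselect (exists c, I c); last first.
  exists 0, 0; split=> [a Ia|i _ a b|j _ a b]; first by case: Inone; exists a.
    by rewrite inE => Ia; case: Inone; exists a.
  by rewrite inE => Ia; case: Inone; exists a.
have [P cP] := Iex c Ic.
have IP a : I a -> kink_index n a P.
  move=> Ia; have [Q aQ] := Iex a Ia.
  have [ac|/ltW ca] := leP a c.
    by rewrite -(kink_index_const Iitv I1 Iex Ia Ic ac aQ cP).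
  by rewrite (kink_index_const Iitv I1 Iex Ic Ia ca cP aQ).
have Pn : (P <= n.+1)%N by case: cP => t [].
have mono a b i (t t' : nat -> R) : I a -> I b -> a < b -> alternant n a t P ->
    alternant n b t' P -> (0 < i <= n)%N -> t i <= t' i.
  move=> Ia Ib ab at_ bt'; have [a1 a2] := I11 a Ia; have [b1 b2] := I11 b Ib.
  by apply: (alternant_mono a1 ab b2 _ _ at_ bt'); apply: minimax_error_gt0.
exists (P%:Z - 1), ((n.+1 - P)%N%:Z - 1); split.
- move=> a Ia; have [t at_] := IP a Ia.
  by rewrite /left_index /right_index (left_pointsE at_) (right_pointsE at_) !size_mkseq.
- move=> i iP a b; rewrite !inE => Ia Ib; rewrite le_eqVlt => /predU1P[->//|ab].
  have [t at_] := IP a Ia; have [t' bt'] := IP b Ib.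
  (* The bound by [k] leaves out the outermost point [t 0], so that the rank [P - i] is positive. *)
  have {}iP : (i < P)%N by lia.
  rewrite (upointE at_ (ltnW iP)) (upointE bt' (ltnW iP)).
  have [i0|i0] := posnP i.
    by case: at_ bt' => _ _ tP _ _ [_ _ t'P _ _]; rewrite i0 subn0 tP t'P ltW.
  by apply: mono at_ bt' _ => //; nlia.
- move=> j jP a b; rewrite !inE => Ia Ib; rewrite le_eqVlt => /predU1P[->//|ab].
  have [t at_] := IP a Ia; have [t' bt'] := IP b Ib.
  have {}jP : (P + j <= n)%N by lia.
  rewrite (vpointE at_) 1?(leqW jP) // (vpointE bt') 1?(leqW jP) //.
  have [j0|j0] := posnP j.
    by case: at_ bt' => _ _ tP _ _ [_ _ t'P _ _]; rewrite j0 addn0 tP t'P ltW.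
  by apply: mono at_ bt' _ => //; nlia.
Qed.
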